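(* Let $N\ge 1$, let $T>0$ be a constant critical gap, and let $\tilde G_{ij}(s)$ be the Laplace–Stieltjes transform of the conditional service time of a minor-road vehicle when every minor-road driver needs the same constant critical gap $T$ (behavior type B$_1$), that is, $$\tilde G_{ij}(s)=\mathbb E\big[e^{-sG}\,1_{\{J(G)=j\}}\,\big|\,J(0)=i\big],\qquad \mathrm{Re}(s)\ge 0,\quad i,j=1,\dots,N,$$ where $G$ is the service time started at time $0$ and $J(\cdot)$ is the background process of the Markov modulated Poisson process of vehicles on the major road. Then the $\tilde G_{ij}(s)$ are the solution to the system of equations $$\tilde G_{ij}(s)=e^{-sT}\phi_{ij}(T)+\sum_{k=1}^{N}\tilde G_{kj}(s)\int_{0}^{T}e^{-st}\,\psi_{ik}(t)\,dt,\qquad i,j=1,2,\dots,N,$$ where $$\phi_{ij}(t)=\mathbb P\big(\text{no car passes on the major road in }[0,t]\text{ and }J(t)=j\,\big|\,J(0)=i\big),\qquad \psi_{ij}(t)=q_j\,\phi_{ij}(t).$$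
   Context: Major road: cars pass according to a Markov modulated Poisson process. The background process $J(t)$, $t\ge 0$, is a continuous-time Markov chain on $\{1,\dots,N\}$ with transition rate matrix $Q=[\mu_{ij}]$, where $-\mu_{ii}=\mu_i=\sum_{j\ne i}\mu_{ij}$, so that $\mathbb P(J(t)=j\mid J(0)=i)=[e^{tQ}]_{ij}$. While $J(t)=i$, cars pass on the major road at Poisson rate $q_i$. Major-road cars are not affected by minor-road vehicles. Minor road: a vehicle at the stop line of the minor road starts its service at time $0$ and scans for a gap on the major road. At the start of service, and again each time a major-road car passes, a new attempt starts. If no major-road car passes during the $T$ time units following the start of the attempt, the vehicle crosses, and its service ends exactly $T$ time units after the start of that attempt. Otherwise the attempt fails at the moment the next major-road car passes, and a new attempt starts at that moment with the same critical gap $T$. The service time $G$ is the total time from the start of service to its end (scanning time plus the crossing time $T$). In the queueing model, $\tilde G_{ij}(s)=\mathbb E[e^{-sG^{(n)}}1_{\{J_{n+1}=j\}}\mid J_n=i, X_{n-1}\ge1]$, where $G^{(n)}$ is the service time of the $n$-th minor-road vehicle, $J_n$ is the phase on the major road when the $(n-1)$-th minor-road vehicle has crossed, and $X_{n-1}$ is the number of minor-road vehicles left behind at that moment. On $X_{n-1}\ge 1$ the $n$-th service starts immediately in phase $J_n$, which gives the expression for $\tilde G_{ij}(s)$ in terms of $J(\cdot)$ and $G$ used in the claim. *)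

(* Defs.v *)
(* MathComp-Analysis, over an arbitrary [R : realType]. *)
From HB Require Import structures.
From mathcomp Require Export all_boot all_order all_algebra.
From mathcomp Require Export all_classical all_reals all_analysis.
From mathcomp Require Export complex.

Set Implicit Arguments.
Unset Strict Implicit.
Unset Printing Implicit Defensive.

Import Order.TTheory GRing.Theory Num.Theory.
Import numFieldNormedType.Exports.

Local Open Scope classical_set_scope.
Local Open Scope ring_scope.
Local Open Scope complex_scope.

Definition cexp (R : realType) (z : R[i]) : R[i] :=
  (expR (complex.Re z))%:C * (cos (complex.Im z) +i* sin (complex.Im z)).

Definition cintegral d (X : measurableType d) (R : realType)
    (mu : {measure set X -> \bar R}) (D : set X) (f : X -> R[i]) : R[i] :=
  (\int[mu]_(x in D) complex.Re (f x)) +i* (\int[mu]_(x in D) complex.Im (f x)).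

Definition expmx (R : realType) (N : nat) (A : 'M[R]_N) : 'M[R]_N :=
  \matrix_(i, j) limn (series (fun k : nat => k`!%:R^-1 * (A ^+ k) i j)).

(* Unlike the library's [poisson_pmf], this is the unit mass at 0 for m = 0. *)
Definition poisson_weight (R : realType) (m : R) (k : nat) : R :=
  m ^+ k / k`!%:R * expR (- m).

Section elementary_conditioning.
Context d (Omega : measurableType d) (R : realType) (P : probability Omega R).

Definition cond_prob (A B : set Omega) : R := fine (P (A `&` B)) / fine (P B).

Definition cond_expectation (f : Omega -> R[i]) (B : set Omega) : R[i] :=
  cintegral P B f / (fine (P B))%:C.

End elementary_conditioning.

Definition rate_matrix (R : realType) (N : nat) (Q : 'M[R]_N) : Prop :=
  (forall i j, i != j -> 0 <= Q i j) /\
  (forall i, - Q i i = \sum_(j | j != i) Q i j).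

Section modulated_process.
Context d (Omega : measurableType d) (R : realType) (P : probability Omega R).
Context (N : nat) (Q : 'M[R]_N) (q : 'I_N -> R).

(* [J t w] is the phase at time [t] and [A t w] the number of cars that pass
   during [0, t]; both are only meaningful for [0 <= t]. *)
Context (J : R -> Omega -> 'I_N) (A : R -> Omega -> nat).

Definition in_phase (t : R) (i : 'I_N) : set Omega := [set w | J t w = i].

Definition markov_chain : Prop :=
  [/\ forall (t : R) (i : 'I_N), 0 <= t -> measurable (in_phase t i),
      forall (w : Omega) (t : R), 0 <= t -> \forall u \near t^'+, J u w = J t w
    & forall (n : nat) (t : nat -> R) (x : nat -> 'I_N),
        t 0%N = 0 -> (forall l, t l <= t l.+1) ->
        P (\bigcap_(l in [set l | (l <= n)%N]) in_phase (t l) (x l)) =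
        (P (in_phase 0 (x 0%N)) *
         (\prod_(l < n) expmx ((t l.+1 - t l) *: Q) (x l) (x l.+1))%:E)%E].

Definition phase_events : set (set Omega) :=
  <<s [set E | exists (t : R) (i : 'I_N), 0 <= t /\ E = in_phase t i] >>.

Definition mean_cars (a b : R) (w : Omega) : R :=
  \int[lebesgue_measure]_(u in `[a, b]) q (J u w).

(* The last field says that, conditionally on the whole trajectory of [J],
   increments of [A] over successive intervals are independent and Poisson,
   with the integrals of the rate [q (J u)] as means. *)
Definition modulated_poisson : Prop :=
  [/\ forall (t : R) (k : nat), 0 <= t -> measurable [set w | A t w = k],
      forall w, A 0 w = 0%N /\
        (forall a b : R, 0 <= a -> a <= b -> (A a w <= A b w)%N),
      forall (w : Omega) (t : R), 0 <= t -> \forall u \near t^'+, A u w = A t w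
    & forall (E : set Omega) (n : nat) (t : nat -> R) (k : nat -> nat),
        phase_events E -> 0 <= t 0%N -> (forall l, t l <= t l.+1) ->
        P (E `&` \bigcap_(l in [set l | (l < n)%N])
                   [set w | (A (t l.+1) w - A (t l) w)%N = k l]) =
        (\int[P]_(w in E)
           (\prod_(l < n) poisson_weight (mean_cars (t l) (t l.+1) w) (k l))%:E)%E].

Definition mmpp : Prop :=
  [/\ rate_matrix Q, forall i, 0 <= q i, markov_chain & modulated_poisson].

Definition no_car_phase (t : R) (i j : 'I_N) : R :=
  cond_prob P ([set w | A t w = 0%N] `&` in_phase t j) (in_phase 0 i).

Definition first_car_density (t : R) (i j : 'I_N) : R :=
  q j * no_car_phase t i j.

Definition attempt_start (u : R) (w : Omega) : Prop :=
  u = 0 \/ (0 < u /\ forall v : R, 0 <= v -> v < u -> (A v w < A u w)%N).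

(* The end of the first successful attempt. Passages after the service has
   ended also count as [attempt_start], but only give larger elements of the
   set, so they do not affect the infimum. The value is +oo on the event that
   every attempt fails. *)
Definition service_time (T : R) (w : Omega) : \bar R :=
  ereal_inf [set (u + T)%:E | u in
    [set u | attempt_start u w /\ A (u + T) w = A u w]].

Definition service_lst (T : R) (s : R[i]) (i j : 'I_N) : R[i] :=
  cond_expectation P
    (fun w => if service_time T w is g%:E
              then cexp (- s * g%:C) * ((J g w == j)%:R : R)%:C
              else 0)
    (in_phase 0 i).

Definition service_system (T : R) (s : R[i]) (X : 'I_N -> 'I_N -> R[i]) : Prop :=
  forall i j,
    X i j = cexp (- s * T%:C) * (no_car_phase T i j)%:C
      + \sum_(k < N) X k j *
          cintegral lebesgue_measure `[0, T]
            (fun t : R => cexp (- s * t%:C) * (first_car_density t i k)%:C).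

End modulated_process.

(* Main.v *)
(** Time is cut into slots of length [h = T / n], and the service is replaced by
    the first [n] consecutive slots without a car.  Conditionally on the phase
    process, the slots are empty independently with probabilities
    [expR (- slot_mean)], and approximating [slot_mean] by Riemann sums turns the
    law of a pattern of slots into a product of matrices, with a factor [K false]
    for each slot without a car and [K true] for each other one.  Splitting at the
    first slot with a car gives a discrete analogue of the system, with coefficients
    [\sum_(p < n) z ^+ p.+1 * K false ^+ p * K true] and [z = cexp (- s * h)].
    As [n] grows, the discretised service ends at times that converge for every
    path, since paths are right-continuous, so the transforms converge by bounded
    convergence; [K false ^+ p] is [no_car_phase] at time [p * h] and
    [K true / h] tends to the diagonal matrix of rates, so the coefficients
    converge as Riemann sums.  The solution is unique because the absolute values
    of the limit coefficients in row [i] add up to at most the probability that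
    the first attempt fails, which is less than 1. *)
Require Import Defs.
From mathcomp Require Import measurable_realfun ring.

Set Implicit Arguments.
Unset Strict Implicit.
Unset Printing Implicit Defensive.

Import Order.TTheory GRing.Theory Num.Theory.
Import numFieldNormedType.Exports.
Import ComplexField.Normc.

Local Open Scope classical_set_scope.
Local Open Scope ring_scope.
Local Open Scope complex_scope.

(** * Bounded convergence and Riemann sums *)

Section bounded_measurable.
Context d (X : measurableType d) (R : realType).
Variable mu : {measure set X -> \bar R}.
Variable D : set X.
Hypotheses (mD : measurable D) (muD : (mu D < +oo)%E).
Implicit Types f g : X -> R.

(** The obstacle is that a car passes at a random time, whereas the hypotheses give laws only at
    deterministic times: finite-dimensional laws of [J], and counts of [A] over fixed intervals
    jointly with phase events. On a grid, the search restarts at the end of a slot with a prescribed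
    index, so the renewal argument reduces to a product of matrices and needs no strong Markov
    property. Since [n] slots of length [T / n] add up to exactly [T], an empty window is a true gap
    that happens to start at a grid point; only the starting time is approximated. The mean number
    of cars in a slot is an integral along the path and is not covered by finite-dimensional laws
    either. Hence a second, inner refinement: each slot is sampled at [r.+1] points and [r] grows
    with the slot length fixed. Nonempty slots enter as differences of unconstrained and empty ones,
    so only exponentials of slot means have to be integrated. *)

Definition bounded_measurable f :=
  measurable_fun D f /\ exists C : R, forall x, D x -> `|f x| <= C.

Lemma bounded_measurable_cst c : bounded_measurable (fun=> c).
Proof. by split; [exact: measurable_cst|exists `|c|]. Qed.

Lemma bounded_measurableD f g : bounded_measurable f -> bounded_measurable g ->
  bounded_measurable (fun x => f x + g x).
Proof.
move=> [mf [a fa]] [mg [b gb]]; split; first exact: measurable_funD.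
by exists (a + b) => x Dx; rewrite (le_trans (ler_normD _ _))// lerD ?fa ?gb.
Qed.

Lemma bounded_measurableM f g : bounded_measurable f -> bounded_measurable g ->
  bounded_measurable (fun x => f x * g x).
Proof.
move=> [mf [a fa]] [mg [b gb]]; split; first exact: measurable_funM.
by exists (a * b) => x Dx; rewrite normrM ler_pM ?fa ?gb.
Qed.

Lemma bounded_measurableN f : bounded_measurable f ->
  bounded_measurable (fun x => - f x).
Proof.
move=> /(bounded_measurableM (bounded_measurable_cst (-1))).
by under eq_fun do rewrite mulN1r.
Qed.

Lemma bounded_measurableB f g : bounded_measurable f -> bounded_measurable g ->
  bounded_measurable (fun x => f x - g x).
Proof.
by move=> mf mg; apply: bounded_measurableD => //; exact: bounded_measurableN.
Qed.

Lemma bounded_measurable_sum (I : Type) (s : seq I) (F : I -> X -> R) :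
  (forall i, bounded_measurable (F i)) ->
  bounded_measurable (fun x => \sum_(i <- s) F i x).
Proof.
move=> mF; elim: s => [|i s IH].
  under eq_fun do rewrite big_nil; exact: bounded_measurable_cst.
under eq_fun do rewrite big_cons; exact: bounded_measurableD.
Qed.

Lemma bounded_measurable_integrable f : bounded_measurable f ->
  mu.-integrable D (EFin \o f).
Proof.
move=> [mf [C fC]]; apply: (le_integrable mD _ _ (g := EFin \o cst C)).
- exact/measurable_EFinP.
- by move=> x Dx /=; rewrite lee_fin (le_trans (fC _ Dx))// ler_norm.
- apply/integrableP; split; first exact/measurable_EFinP/measurable_cst.
  by rewrite /= integral_cst// lte_mul_pinfty.
Qed.

Lemma bounded_measurable_cvg (f_ : nat -> X -> R) f (C : R) :
  (forall n, measurable_fun D (f_ n)) ->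
  (forall n x, D x -> `|f_ n x| <= C) ->
  (forall x, D x -> f_ ^~ x @ \oo --> f x) -> bounded_measurable f.
Proof.
move=> mf fC ff; split; first exact: measurable_fun_cvg mf ff.
exists C => x Dx; have fx : `|f_ n x| @[n --> \oo] --> `|f x|.
  by apply: cvg_norm; exact: ff.
rewrite -(cvg_lim _ fx)//; apply: limr_le; first by apply/cvg_ex; exists `|f x|.
by apply: nearW => n; exact: fC.
Qed.

Lemma bounded_Rintegral_cvg (f_ : nat -> X -> R) f (C : R) :
  (forall n, measurable_fun D (f_ n)) ->
  (forall n x, D x -> `|f_ n x| <= C) ->
  (forall x, D x -> f_ ^~ x @ \oo --> f x) ->
  \int[mu]_(x in D) f_ n x @[n --> \oo] --> \int[mu]_(x in D) f x.
Proof.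
move=> mf fC ff.
have iC : mu.-integrable D (EFin \o cst C).
  exact: bounded_measurable_integrable (bounded_measurable_cst C).
have mf_ n : measurable_fun D (EFin \o f_ n) by exact/measurable_EFinP.
have ff_ x : D x -> (EFin \o f_ n) x @[n --> \oo] --> (EFin \o f) x.
  by move=> Dx; apply: cvg_EFin; [exact: nearW|exact: ff].
have fC_ n x : D x -> (`|(EFin \o f_ n) x| <= (EFin \o cst C) x)%E.
  by move=> Dx; rewrite lee_fin fC.
have finC x : D x -> (EFin \o cst C) x \is a fin_num by [].
have := dominated_cvg mD mf_ ff_ finC iC fC_.
rewrite -[X in _ --> X]fineK; first exact: fine_cvg.
apply: integrable_fin_num => //; apply: bounded_measurable_integrable.
exact: bounded_measurable_cvg mf fC ff.
Qed.

Lemma Rintegral_sum (I : Type) (s : seq I) (F : I -> X -> R) :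
  (forall i, bounded_measurable (F i)) ->
  \int[mu]_(x in D) (\sum_(i <- s) F i x) =
  \sum_(i <- s) \int[mu]_(x in D) F i x.
Proof.
move=> mF; elim: s => [|i s IH].
  rewrite big_nil; under eq_Rintegral do rewrite big_nil.
  by rewrite Rintegral_cst// mul0r.
rewrite big_cons -IH; under eq_Rintegral do rewrite big_cons.
rewrite RintegralD//; apply: bounded_measurable_integrable => //.
exact: bounded_measurable_sum.
Qed.

Lemma RintegralZ c f : bounded_measurable f ->
  \int[mu]_(x in D) (c * f x) = c * \int[mu]_(x in D) f x.
Proof. by move=> mf; rewrite RintegralZl//; exact: bounded_measurable_integrable. Qed.

End bounded_measurable.

Section right_riemann_sums.
Context (R : realType).
Implicit Types (f : R -> R) (a h u e : R).

Lemma near_at_rightP u (Q : R -> Prop) : (\forall v \near u^'+, Q v) ->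
  exists2 e, 0 < e & forall v, u < v -> v < u + e -> Q v.
Proof.
move=> [e /= e0 He]; exists e => // v uv ve; apply: He => //=.
by rewrite ltr_distlC ltrBlDr (lt_trans uv) ?ltrDl.
Qed.

Lemma near_mesh_lt h e : 0 < e -> \forall r \near \oo, h / r.+1%:R < e.
Proof.
move=> e0; near=> r; rewrite ltr_pdivrMr// -ltr_pdivrMl//.
rewrite (le_lt_trans (ler_norm _))// (lt_le_trans (truncnS_gt _))//.
rewrite ler_nat ltnS.
by near: r; exact: nbhs_infty_ge.
Unshelve. all: by end_near. Qed.

(* Right endpoints, because the paths of the phase process need not have left limits. *)
Definition step_right f a h (r : nat) u : R :=
  \sum_(p < r.+1) f (a + p.+1%:R * (h / r.+1%:R)) *
    \1_`[a + p%:R * (h / r.+1%:R), a + p.+1%:R * (h / r.+1%:R)[ u.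

(** Cells are closed on the left and open on the right, so the sample point lies strictly to the
    right of [u], as right-continuity requires. The bound [v <= a + h] keeps it where [f] is assumed
    bounded. *)
Lemma step_rightE f a h r u : 0 < h -> a <= u -> u < a + h ->
  exists v, [/\ u < v, v <= u + h / r.+1%:R, v <= a + h &
    step_right f a h r u = f v].
Proof.
move=> h0 au uh; set D := h / r.+1%:R.
have D0 : 0 < D by rewrite divr_gt0.
have ua0 : 0 <= (u - a) / D by rewrite divr_ge0 ?subr_ge0 ?(ltW D0).
have := truncn_itv ua0; set p := Num.truncn _ => /andP[pu up].
rewrite ler_pdivlMr// in pu; rewrite ltr_pdivrMr// in up.
have pr : (p < r.+1)%N.
  rewrite -(ltr_nat R) -(ltr_pM2r D0) (le_lt_trans pu)//.
  by rewrite /D mulrC divfK// ltrBlDl.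
exists (a + p.+1%:R * D); split.
- by rewrite -ltrBlDl.
- by rewrite -natr1 mulrDl mul1r addrA lerD2r -lerBrDl.
- by rewrite lerD2l (_ : h = r.+1%:R * D) ?ler_pM2r ?ler_nat// /D mulrC divfK.
rewrite /step_right (bigD1 (Ordinal pr))//= big1 ?addr0; last first.
  move=> i; rewrite -val_eqE /= => ip; rewrite indicE.
  case: (boolP (u \in _)) => //=; rewrite ?mulr0// inE/= in_itv/= -/D => /andP[iu ui].
  exfalso; move: ip; apply/negP; rewrite negbK eqn_leq.
  apply/andP; split; rewrite -ltnS -(ltr_nat R) -(ltr_pM2r D0).
    by rewrite (le_lt_trans _ up)// lerBrDl.
  by rewrite (le_lt_trans pu)// ltrBlDl.
by rewrite indicE mem_set ?mulr1//= in_itv/= -/D -lerBrDl pu -ltrBlDl up.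
Qed.

Lemma measurable_step_right f a h r : measurable_fun setT (step_right f a h r).
Proof.
by apply: measurable_sum => p; apply: measurable_funM.
Qed.

Lemma Rintegral_step_right f a h r : 0 < h ->
  \int[lebesgue_measure]_(u in `[a, (a + h)%R[) step_right f a h r u =
  \sum_(p < r.+1) h / r.+1%:R * f (a + p.+1%:R * (h / r.+1%:R)).
Proof.
move=> h0; rewrite /step_right; set D := h / r.+1%:R.
have D0 : 0 < D by rewrite divr_gt0.
have muD : (lebesgue_measure `[a, (a + h)%R[%classic < +oo)%E.
  by rewrite lebesgue_measure_itv/=; case: ifP; rewrite ?ltry.
have bI (p : nat) : bounded_measurable `[a, (a + h)%R[
    (\1_`[a + p%:R * D, a + p.+1%:R * D[ : R -> R).
  split; first exact: measurable_funTS.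
  by exists 1 => x _; rewrite indicE; case: (_ \in _); rewrite ?normr0 ?normr1.
rewrite Rintegral_sum//; last first.
  by move=> p; apply: bounded_measurableM; [exact: bounded_measurable_cst|exact: bI].
apply: eq_bigr => p _; rewrite RintegralZ//; last exact: bI.
rewrite mulrC; congr (_ * _).
rewrite /Rintegral integral_indic//= setIidl; last first.
  move=> x /=; rewrite !in_itv/= => /andP[px xp]; apply/andP; split.
    by apply: le_trans px; rewrite lerDl mulr_ge0// ltW.
  apply: lt_le_trans xp _; rewrite lerD2l.
  by rewrite (_ : h = r.+1%:R * D) ?ler_pM2r ?ler_nat// /D mulrC divfK.
rewrite lebesgue_measure_itv/= lte_fin ltrD2l ltr_pM2r// ltr_nat ltnS leqnn.
by rewrite -EFinB/= -natr1; ring.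
Qed.

Lemma right_riemann_sum_cvg f a h (C : R) : 0 < h ->
  (forall u, a <= u -> u <= a + h -> `|f u| <= C) ->
  (forall u, a <= u -> u < a + h -> f v @[v --> u^'+] --> f u) ->
  \sum_(p < r.+1) h / r.+1%:R * f (a + p.+1%:R * (h / r.+1%:R)) @[r --> \oo] -->
  \int[lebesgue_measure]_(u in `[a, (a + h)%R]) f u.
Proof.
move=> h0 fC fr; under eq_fun do rewrite -Rintegral_step_right//.
have muD : (lebesgue_measure `[a, (a + h)%R[%classic < +oo)%E.
  by rewrite lebesgue_measure_itv/=; case: ifP; rewrite ?ltry.
have mg r : measurable_fun `[a, (a + h)%R[ (step_right f a h r).
  by apply: measurable_funTS; exact: measurable_step_right.
have gC r u : `[a, (a + h)%R[%classic u -> `|step_right f a h r u| <= C.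
  rewrite /= in_itv/= => /andP[au uh].
  by have [v [uv _ vh ->]] := step_rightE f r h0 au uh; rewrite fC// (le_trans au)// ltW.
have gf u : `[a, (a + h)%R[%classic u -> step_right f a h ^~ u @ \oo --> f u.
  rewrite /= in_itv/= => /andP[au uh]; apply/cvgrPdist_lt => e e0.
  have /cvgrPdist_lt/(_ e e0)/near_at_rightP[c c0 Hc] := fr _ au uh.
  near=> r; have [v [uv vD _ ->]] := step_rightE f r h0 au uh.
  apply: Hc => //; rewrite (le_lt_trans vD)// ltrD2l.
  by near: r; exact: near_mesh_lt.
(* The endpoint [a + h] is discarded as a null set: every step function vanishes there, and no
   continuity of [f] is assumed at it. *)
rewrite -Rintegral_itv_bndo_bndc; last first.
  apply: bounded_measurable_integrable => //.
  exact: bounded_measurable_cvg mg gC gf.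
have mD : measurable (`[a, (a + h)%R[%classic : set R) by [].
apply: (@bounded_Rintegral_cvg _ _ R lebesgue_measure _ mD muD _ _ _ mg gC gf).
Unshelve. all: by end_near. Qed.

End right_riemann_sums.

(** * Limits of complex-valued functions *)

Definition ccvg (T : Type) (F : set_system T) (R : realType)
    (u : T -> R[i]) (l : R[i]) :=
  complex.Re (u n) @[n --> F] --> complex.Re l /\
  complex.Im (u n) @[n --> F] --> complex.Im l.

Section complex_limits.
Context (R : realType).
Context (T : Type) (F : set_system T) {FF : ProperFilter F}.
Implicit Types (u v : T -> R[i]) (l m z s : R[i]).

Lemma complex_ReD z z' : complex.Re (z + z') = complex.Re z + complex.Re z'.
Proof. by case: z z' => [a b] [c e]. Qed.

Lemma complex_ImD z z' : complex.Im (z + z') = complex.Im z + complex.Im z'.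
Proof. by case: z z' => [a b] [c e]. Qed.

Lemma complex_Re_sum (I : Type) (r : seq I) (G : I -> R[i]) :
  complex.Re (\sum_(i <- r) G i) = \sum_(i <- r) complex.Re (G i).
Proof.
by elim: r => [|i r IH]; rewrite ?big_nil// !big_cons complex_ReD IH.
Qed.

Lemma complex_Im_sum (I : Type) (r : seq I) (G : I -> R[i]) :
  complex.Im (\sum_(i <- r) G i) = \sum_(i <- r) complex.Im (G i).
Proof.
by elim: r => [|i r IH]; rewrite ?big_nil// !big_cons complex_ImD IH.
Qed.

Lemma complex_ReM z z' : @complex.Re R (z * z') =
  complex.Re z * complex.Re z' - complex.Im z * complex.Im z'.
Proof. by case: z z' => [a b] [c e]. Qed.

Lemma complex_ImM z z' : @complex.Im R (z * z') =
  complex.Re z * complex.Im z' + complex.Im z * complex.Re z'.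
Proof. by case: z z' => [a b] [c e]. Qed.

Lemma ccvg_cst l : ccvg F (fun=> l) l.
Proof. by split; exact: cvg_cst. Qed.

Lemma ccvgD u v l m : ccvg F u l -> ccvg F v m -> ccvg F (fun n => u n + v n) (l + m).
Proof.
move=> [ru iu] [rv iv]; split.
  by rewrite complex_ReD; under eq_fun do rewrite complex_ReD; exact: cvgD.
by rewrite complex_ImD; under eq_fun do rewrite complex_ImD; exact: cvgD.
Qed.

Lemma ccvgM u v l m : ccvg F u l -> ccvg F v m -> ccvg F (fun n => u n * v n) (l * m).
Proof.
move=> [ru iu] [rv iv]; split.
  by rewrite complex_ReM; under eq_fun do rewrite complex_ReM; apply: cvgB; exact: cvgM.
by rewrite complex_ImM; under eq_fun do rewrite complex_ImM; apply: cvgD; exact: cvgM.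
Qed.

Lemma ccvg_real (a : T -> R) (b : R) :
  a @ F --> b -> ccvg F (fun n => (a n)%:C) b%:C.
Proof. by move=> ab; split => //=; exact: cvg_cst. Qed.

Lemma ccvg_sum (I : Type) (r : seq I) (u : I -> T -> R[i]) (l : I -> R[i]) :
  (forall i, ccvg F (u i) (l i)) ->
  ccvg F (fun n => \sum_(i <- r) u i n) (\sum_(i <- r) l i).
Proof.
move=> ul; elim: r => [|i r IH].
  by under eq_fun do rewrite big_nil; rewrite big_nil; exact: ccvg_cst.
by under eq_fun do rewrite big_cons; rewrite big_cons; exact: ccvgD.
Qed.

Lemma ccvg_unique u l m : ccvg F u l -> ccvg F u m -> l = m.
Proof.
move=> [rl il] [rm im]; apply/eqP; rewrite eq_complex; apply/andP.
split; apply/eqP; [exact: cvg_unique rl rm|exact: cvg_unique il im].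
Qed.

Lemma ccvg_near u v l : (\forall n \near F, u n = v n) -> ccvg F u l -> ccvg F v l.
Proof.
move=> uv [ru iu]; split.
  by apply: cvg_trans ru; apply: near_eq_cvg; apply: filterS uv => n /= ->.
by apply: cvg_trans iu; apply: near_eq_cvg; apply: filterS uv => n /= ->.
Qed.

Lemma normc_sqrt z :
  normc z = Num.sqrt (complex.Re z ^+ 2 + complex.Im z ^+ 2).
Proof. by case: z. Qed.

Lemma ccvg_normc u l : ccvg F u l -> normc (u n) @[n --> F] --> normc l.
Proof.
move=> [ru iu]; under eq_fun do rewrite normc_sqrt; rewrite normc_sqrt.
apply: continuous_cvg; first exact: sqrt_continuous.
by apply: cvgD; rewrite expr2; under eq_fun do rewrite expr2; exact: cvgM.
Qed.

Lemma normc_sum (I : Type) (r : seq I) (G : I -> R[i]) :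
  normc (\sum_(i <- r) G i) <= \sum_(i <- r) normc (G i).
Proof.
elim: r => [|i r IH]; first by rewrite !big_nil ComplexField.Normc.normc0.
by rewrite !big_cons (le_trans (le_normcD _ _))// lerD2l.
Qed.

Lemma normc_ge0 z : 0 <= normc z.
Proof. by rewrite normc_sqrt sqrtr_ge0. Qed.

Lemma normc_ge_absRe z : `|complex.Re z| <= normc z.
Proof. by rewrite normc_sqrt -sqrtr_sqr ler_wsqrtr// lerDl sqr_ge0. Qed.

Lemma normc_ge_absIm z : `|complex.Im z| <= normc z.
Proof. by rewrite normc_sqrt -sqrtr_sqr ler_wsqrtr// lerDr sqr_ge0. Qed.

Lemma normc_real (a : R) : 0 <= a -> normc a%:C = a.
Proof. by move=> a0; rewrite normc_sqrt/= expr0n addr0 sqrtr_sqr ger0_norm. Qed.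

Lemma normc_cexp z : normc (cexp z) = expR (complex.Re z).
Proof.
rewrite /cexp ComplexField.Normc.normcM normc_real ?expR_ge0// normc_sqrt/= cos2Dsin2 sqrtr1.
by rewrite mulr1.
Qed.

Lemma cexp0 : cexp (0 : R[i]) = 1.
Proof. by rewrite /cexp/= expR0 cos0 sin0 mul1r. Qed.

Lemma cexpD z z' : cexp (z + z') = cexp z * cexp z'.
Proof.
rewrite /cexp complex_ReD complex_ImD expRD cosD sinD rmorphM/= mulrACA; congr (_ * _).
by apply/eqP; rewrite eq_complex/= eqxx addrC eqxx.
Qed.

Lemma cexp_ccvg u l : ccvg F u l -> ccvg F (fun n => cexp (u n)) (cexp l).
Proof.
move=> [ru iu]; apply: ccvgM.
  by apply: ccvg_real; apply: continuous_cvg => //; exact: continuous_expR.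
split=> /=; apply: continuous_cvg => //.
  exact: continuous_cos.
exact: continuous_sin.
Qed.

End complex_limits.

Lemma ccvg_shift (R : realType) (u : nat -> R[i]) l k :
  ccvg \oo u l -> ccvg \oo (fun n => u (n - k)%N) l.
Proof.
move=> [ru iu]; split.
  by rewrite -(cvg_shiftn k)/=; under eq_fun do rewrite addnK.
by rewrite -(cvg_shiftn k)/=; under eq_fun do rewrite addnK.
Qed.

(** * Transfer matrices of the phase process *)

Section process_facts.
Context d (Omega : measurableType d) (R : realType) (P : probability Omega R).
Context (N : nat) (Q : 'M[R]_N) (q : 'I_N -> R).
Context (J : R -> Omega -> 'I_N) (A : R -> Omega -> nat).

Lemma probability_lty (E : set Omega) : measurable E -> (P E < +oo)%E.
Proof. by move=> mE; rewrite (le_lt_trans (probability_le1 P mE))// ltry. Qed.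

Lemma measurable_in_phase t i : markov_chain P Q J -> 0 <= t ->
  measurable (in_phase J t i).
Proof. by move=> [+ _ _]; exact. Qed.

Lemma phase_right_cst w t : markov_chain P Q J -> 0 <= t ->
  \forall u \near t^'+, J u w = J t w.
Proof. by move=> [_ + _]; exact. Qed.

Lemma measurable_count_eq t k : modulated_poisson P q J A -> 0 <= t ->
  measurable [set w | A t w = k].
Proof. by move=> [+ _ _ _]; exact. Qed.

Lemma count0 w : modulated_poisson P q J A -> A 0 w = 0%N.
Proof. by move=> [_ /(_ w)[]]. Qed.

Lemma count_mono w a b : modulated_poisson P q J A -> 0 <= a -> a <= b ->
  (A a w <= A b w)%N.
Proof. by move=> [_ /(_ w)[_ +] _ _]; exact. Qed.

Lemma count_right_cst w t : modulated_poisson P q J A -> 0 <= t ->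
  \forall u \near t^'+, A u w = A t w.
Proof. by move=> [_ _ + _]; exact. Qed.

End process_facts.

Section phase_process.
Context d (Omega : measurableType d) (R : realType) (P : probability Omega R).
Context (N : nat) (Q : 'M[R]_N) (J : R -> Omega -> 'I_N).
Hypothesis JQ : markov_chain P Q J.

Let Jm t i := @measurable_in_phase _ _ _ _ _ _ _ t i JQ.

Notation bm := (bounded_measurable (@setT Omega)).
Local Notation Ex := (Rintegral P setT).

Let PT := probability_lty P measurableT.
Local Hint Resolve PT : core.

Lemma bounded_measurable_indic (E : set Omega) : measurable E -> bm (\1_E : _ -> R).
Proof.
move=> mE; split; first exact: measurable_indic.
by exists 1 => w _; rewrite indicE; case: (_ \in _); rewrite ?normr0 ?normr1.
Qed.

Lemma bounded_measurable_phase (g : 'I_N -> R) t : 0 <= t ->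
  bm (fun w => g (J t w)).
Proof.
move=> t0; have -> : (fun w => g (J t w)) =
    (fun w => \sum_i g i * \1_(in_phase J t i) w).
  apply/funext => w; rewrite (bigD1 (J t w))//= big1 ?addr0.
    by rewrite indicE mem_set ?mulr1.
  move=> i iJ; rewrite indicE memNset ?mulr0//= => iE.
  by move: iJ; rewrite iE eqxx.
apply: bounded_measurable_sum => // i; apply: bounded_measurableM => //.
  exact: bounded_measurable_cst.
by apply: bounded_measurable_indic; exact: Jm.
Qed.

Lemma Ex_indic (E : set Omega) : measurable E -> Ex (\1_E : _ -> R) = fine (P E).
Proof. by move=> mE; rewrite /Rintegral integral_indic// setIT. Qed.

Definition cylinder (t : nat -> R) (x : nat -> 'I_N) (m : nat) : set Omega :=
  \bigcap_(l in [set l | (l <= m)%N]) in_phase J (t l) (x l).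

(** A discrete Feynman-Kac kernel. The weight is taken at the arrival state, in agreement with the
    right endpoints of the Riemann sums. *)
Definition grid_step (D : R) (f : 'I_N -> R) : 'M[R]_N :=
  \matrix_(i, k) (expmx (D *: Q) i k * f k).

Fixpoint phase_prod (D : R) m (fs : seq ('I_N -> R)) j w : R :=
  if fs is f :: fs' then f (J (m.+1%:R * D) w) * phase_prod D m.+1 fs' j w
  else (J (m%:R * D) w == j)%:R.

Section grid.
Variable D : R.
Hypothesis D0 : 0 <= D.
Let t (l : nat) := l%:R * D.

Let t_ge0 l : 0 <= t l. Proof. by rewrite mulr_ge0. Qed.

Lemma measurable_cylinder x m : measurable (cylinder t x m).
Proof.
apply: bigcap_measurableType.
by move=> l _; exact: Jm.
Qed.

Lemma bounded_measurable_phase_prod m fs j : bm (phase_prod D m fs j).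
Proof.
elim: fs m => [|f fs IH] m /=.
  by apply: (bounded_measurable_phase (fun k => (k == j)%:R)); exact: t_ge0.
apply: bounded_measurableM => //; apply: bounded_measurable_phase; exact: t_ge0.
Qed.

Lemma cylinderS x m y :
  fine (P (cylinder t (fun l => if l == m.+1 then y else x l) m.+1)) =
  fine (P (cylinder t x m)) * expmx (D *: Q) (x m) y.
Proof.
move: JQ => [_ _ fdd]; have t00 : t 0 = 0 by rewrite /t mul0r.
have tS l : t l <= t l.+1 by rewrite ler_wpM2r ?ler_nat.
rewrite /cylinder !fdd// big_ord_recr/= eqxx ltn_eqF//.
have -> : t m.+1 - t m = D by rewrite /t -natr1; ring.
have Pfin : P (in_phase J 0 (x 0%N)) \is a fin_num.
  by apply: fin_num_measure; exact: Jm.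
rewrite !fineM//= mulrA; congr (_ * _ * _); apply: eq_bigr => l _.
by rewrite eqSS (ltn_eqF (ltn_ord l)) (ltn_eqF (leqW (ltn_ord l))).
Qed.

Lemma cylinder_split x m w (a : R) :
  \1_(cylinder t x m) w * a =
  \sum_y \1_(cylinder t (fun l => if l == m.+1 then y else x l) m.+1) w *
    ((J (t m.+1) w == y)%:R * a).
Proof.
rewrite (bigD1 (J (t m.+1) w))//= eqxx mul1r big1 ?addr0; last first.
  by move=> y /negPf yJ; rewrite eq_sym yJ mul0r mulr0.
congr (_ * _); rewrite !indicE; congr (_%:R); congr nat_of_bool.
apply/idP/idP; rewrite !inE => H l /= lm; last first.
  by have := H l (leqW lm); rewrite ltn_eqF.
by case: eqP => [->//|/eqP lm1]; apply: H; rewrite /= -ltnS ltn_neqAle lm1.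
Qed.

(** The finite-dimensional laws describe only paths observed from time 0, so the induction carries
    the whole past in the cylinder. The law of the extended cylinder then plays the role of the
    Markov property. *)
Lemma Ex_phase_prod x m fs j :
  Ex (fun w => \1_(cylinder t x m) w * phase_prod D m fs j w) =
  fine (P (cylinder t x m)) * (\prod_(f <- fs) grid_step D f) (x m) j.
Proof.
elim: fs x m => [|f fs IH] x m /=.
  rewrite big_nil mxE (_ : (fun w => _) =
      (fun w => (x m == j)%:R * \1_(cylinder t x m) w)); last first.
    apply/funext => w; rewrite mulrC indicE.
    case: (boolP (w \in _)); rewrite ?mulr0// inE => /(_ m (leqnn m))/= Jx.
    by have -> : J (m%:R * D) w = x m := Jx.
  rewrite RintegralZ//; last by apply: bounded_measurable_indic; exact: measurable_cylinder.
  rewrite mulrC; congr (_ * _); apply: Ex_indic; exact: measurable_cylinder.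
(* Splitting over the next grid phase lengthens the cylinder by one point, on which the factor [f]
   is constant. *)
transitivity (Ex (fun w => \sum_y
    \1_(cylinder t (fun l => if l == m.+1 then y else x l) m.+1) w *
    ((J (t m.+1) w == y)%:R * (f (J (t m.+1) w) * phase_prod D m.+1 fs j w)))).
  by apply: eq_Rintegral => w _; exact: cylinder_split.  
rewrite Rintegral_sum//; last first.
  move=> y; apply: bounded_measurableM => //.
    by apply: bounded_measurable_indic; exact: measurable_cylinder.
  apply: bounded_measurableM => //.
    by apply: (bounded_measurable_phase (fun k => (k == y)%:R)); exact: t_ge0.
  apply: bounded_measurableM => //; last exact: bounded_measurable_phase_prod.
  by apply: bounded_measurable_phase; exact: t_ge0.
rewrite big_cons mxE mulr_sumr; apply: eq_bigr => y _.
rewrite mxE; pose x' l := if l == m.+1 then y else x l.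
have x'y : x' m.+1 = y by rewrite /x' eqxx.
transitivity (f y *
    Ex (fun w => \1_(cylinder t x' m.+1) w * phase_prod D m.+1 fs j w)).
  rewrite -RintegralZ//; last first.
    apply: bounded_measurableM => //; last exact: bounded_measurable_phase_prod.
    by apply: bounded_measurable_indic; exact: measurable_cylinder.
  apply: eq_Rintegral => w _; rewrite -/x' indicE.
  case: (boolP (w \in _)); rewrite ?(mul0r, mulr0)// inE => /(_ m.+1 (leqnn _)).
  by rewrite /= x'y => -> ; rewrite eqxx !mul1r.
by rewrite IH x'y cylinderS; ring.
Qed.

End grid.

Lemma phase_prod_nseq D m k f fs j w :
  phase_prod D m (nseq k f ++ fs) j w =
  \prod_(p < k) f (J ((m + p.+1)%:R * D) w) * phase_prod D (m + k) fs j w.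
Proof.
elim: k m => [|k IH] m /=; first by rewrite big_ord0 mul1r addn0.
rewrite IH big_ord_recl /= mulrA addn1 addSnnS; congr (_ * _ * _).
by apply: eq_bigr => p _; rewrite addSnnS.
Qed.

End phase_process.

(** * Slot kernels as limits of sampled transfer matrices *)

Section slots.
Context d (Omega : measurableType d) (R : realType) (P : probability Omega R).
Context (N : nat) (Q : 'M[R]_N) (q : 'I_N -> R) (J : R -> Omega -> 'I_N).
Hypothesis q0 : forall i, 0 <= q i.
Hypothesis JQ : markov_chain P Q J.
Hypothesis J0 : forall i : 'I_N, (0 < P (in_phase J 0 i))%E.
Variable h : R.
Hypothesis h0 : 0 < h.

Let Jm t i := @measurable_in_phase _ _ _ _ _ _ _ t i JQ.

Let Jr w t := @phase_right_cst _ _ _ _ _ _ _ w t JQ.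

Local Notation bm := (bounded_measurable (@setT Omega)).
Local Notation Ex := (Rintegral P setT).

Let PT := probability_lty P measurableT.
Local Hint Resolve PT : core.

Lemma initial_phase_gt0 i : 0 < fine (P (in_phase J 0 i)).
Proof.
by rewrite fine_gt0// J0/= ltey_eq fin_num_measure//; exact: Jm.
Qed.

Lemma phase_rate_cvg w u : 0 <= u -> q (J v w) @[v --> u^'+] --> q (J u w).
Proof.
move=> u0; apply: cvg_near_cst; apply: filterS (Jr w u0) => v -> //.
Qed.

Definition slot_mean l w := mean_cars q J (l%:R * h) (l%:R * h + h) w.

Definition slot_sample r l w := \sum_(p < r.+1)
  h / r.+1%:R * q (J (l%:R * h + p.+1%:R * (h / r.+1%:R)) w).

Lemma rate_le i : q i <= \sum_k q k.
Proof. by rewrite (bigD1 i)//= lerDl sumr_ge0. Qed.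

Lemma slot_sample_cvg l w : (fun r => slot_sample r l w) @ \oo --> slot_mean l w.
Proof.
apply: (right_riemann_sum_cvg (f := fun u => q (J u w)) (C := \sum_k q k)) => //.
  by move=> u _ _; rewrite ger0_norm// rate_le.
by move=> u lu _; apply: phase_rate_cvg; apply: le_trans lu; rewrite mulr_ge0// ltW.
Qed.

Lemma slot_sample_ge0 r l w : 0 <= slot_sample r l w.
Proof. by apply: sumr_ge0 => p _; rewrite mulr_ge0// divr_ge0// ltW. Qed.

Lemma slot_sample_le r l w : slot_sample r l w <= h * \sum_k q k.
Proof.
apply: (@le_trans _ _ (\sum_(p < r.+1) h / r.+1%:R * \sum_k q k)).
  by apply: ler_sum => p _; rewrite ler_wpM2l ?rate_le// divr_ge0// ltW.
by rewrite sumr_const card_ord -(mulr_natl (h / r.+1%:R * _)) mulrA mulrCA mulfV ?mulr1.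
Qed.

Lemma slot_mean_ge0 l w : 0 <= slot_mean l w.
Proof. by apply: Rintegral_ge0. Qed.

Lemma slot_mean_le l w : slot_mean l w <= h * \sum_k q k.
Proof.
rewrite -(cvg_lim _ (@slot_sample_cvg l w))//; apply: limr_le.
  by apply/cvg_ex; exists (slot_mean l w); exact: slot_sample_cvg.
by apply: nearW => r; exact: slot_sample_le.
Qed.

Lemma bounded_measurable_slot_sample r l : bm (slot_sample r l).
Proof.
apply: bounded_measurable_sum => // p.
apply: bounded_measurableM => //; first exact: bounded_measurable_cst.
apply: (bounded_measurable_phase JQ).
by rewrite addr_ge0// mulr_ge0// ?divr_ge0// ltW.
Qed.

(** For the coefficients 0 and 1, the factor [expR (- (c * L l w))] is respectively 1, for an
    unconstrained slot, and the conditional probability that no car passes in a slot of mean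
    [L l w]. *)
Fixpoint slot_weight (L : nat -> Omega -> R) l (cs : seq R) w : R :=
  if cs is c :: cs' then expR (- (c * L l w)) * slot_weight L l.+1 cs' w else 1.

Lemma measurable_slot_weight L l cs : (forall l, measurable_fun setT (L l)) ->
  measurable_fun setT (slot_weight L l cs).
Proof.
move=> mL; elim: cs l => [|c cs IH] l /=; first exact: measurable_cst.
apply: measurable_funM => //.
by apply: measurableT_comp => //; apply: measurableT_comp => //; exact: measurable_funM.
Qed.

Lemma slot_weight_ge0 L l cs w : 0 <= slot_weight L l cs w.
Proof. by elim: cs l => //= c cs IH l; rewrite mulr_ge0// expR_ge0. Qed.

Lemma slot_weight_le1 L l cs w : (forall l, 0 <= L l w) ->
  all (fun c => 0 <= c) cs -> slot_weight L l cs w <= 1.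
Proof.
move=> L0; elim: cs l => //= c cs IH l /andP[c0 cs0].
rewrite mulr_ile1 ?IH ?expR_ge0 ?slot_weight_ge0//.
by rewrite -expR0 ler_expR oppr_le0 mulr_ge0.
Qed.

Lemma slot_weight_cvg (L_ : nat -> nat -> Omega -> R) L l cs w :
  (forall l, (fun r => L_ r l w) @ \oo --> L l w) ->
  (fun r => slot_weight (L_ r) l cs w) @ \oo --> slot_weight L l cs w.
Proof.
move=> LL; elim: cs l => [|c cs IH] l /=; first exact: cvg_cst.
apply: cvgM => //; apply: continuous_cvg; first exact: continuous_expR.
by apply: cvgN; apply: cvgMr.
Qed.

Definition sample_step r c : 'M[R]_N :=
  grid_step Q (h / r.+1%:R) (fun k => expR (- (c * (h / r.+1%:R * q k)))) ^+ r.+1.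

Lemma phase_prod_slots r l cs j w :
  phase_prod J (h / r.+1%:R) (l * r.+1) (flatten
    [seq nseq r.+1 (fun k => expR (- (c * (h / r.+1%:R * q k)))) | c <- cs]) j w =
  slot_weight (slot_sample r) l cs w * (J ((l + size cs)%:R * h) w == j)%:R.
Proof.
have hE : r.+1%:R * (h / r.+1%:R) = h by rewrite mulrC divfK.
elim: cs l => [|c cs IH] l.
  by rewrite /= mul1r addn0 natrM -mulrA hE.
rewrite [LHS](phase_prod_nseq _ _ (l * r.+1) r.+1) -mulSnr IH [size _]/= addSnnS.
rewrite [slot_weight _ _ _ _]/= -mulrA; congr (_ * _).
rewrite /slot_sample mulr_sumr -sumrN expR_sum; apply: eq_bigr => p _.
by rewrite natrD natrM mulrDl -(mulrA l%:R) hE.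
Qed.

Lemma Ex_slot_sample r i cs j :
  Ex (fun w => \1_(in_phase J 0 i) w * (slot_weight (slot_sample r) 0 cs w *
    (J ((size cs)%:R * h) w == j)%:R)) =
  fine (P (in_phase J 0 i)) * (\prod_(c <- cs) sample_step r c) i j.
Proof.
have D0 : 0 <= h / r.+1%:R by rewrite divr_ge0// ltW.
have := Ex_phase_prod JQ D0 (fun=> i) 0 (flatten
    [seq nseq r.+1 (fun k => expR (- (c * (h / r.+1%:R * q k)))) | c <- cs]) j.
have -> : cylinder J (fun l => l%:R * (h / r.+1%:R)) (fun=> i) 0 = in_phase J 0 i.
  apply/seteqP; split=> w; first by move=> /(_ 0%N (leqnn _)); rewrite mul0r.
  by move=> Jw l /=; rewrite leqn0 => /eqP ->; rewrite mul0r.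
have -> : \prod_(f <- flatten
    [seq nseq r.+1 (fun k => expR (- (c * (h / r.+1%:R * q k)))) | c <- cs])
    grid_step Q (h / r.+1%:R) f = \prod_(c <- cs) sample_step r c.
  elim: cs => [|c cs IH]; first by rewrite !big_nil.
  rewrite [RHS]big_cons -IH [LHS](big_cat _ (nseq r.+1 _)) /sample_step.
  by rewrite big_nseq iter_mulr_1.
move=> <-; apply: eq_Rintegral => w _.
by have := phase_prod_slots r 0 cs j w; rewrite mul0n add0n => ->.
Qed.

Lemma measurable_slot_mean l : measurable_fun setT (slot_mean l).
Proof.
apply: (measurable_fun_cvg (h := slot_sample^~ l)).
  by move=> r; have [] := bounded_measurable_slot_sample r l.
by move=> w _; exact: slot_sample_cvg.
Qed.

(* For [c = 0] this is the transition matrix of the phase over one slot; for [c = 1]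
   it is restricted to the event that no car passes. *)
Definition slot_kernel c : 'M[R]_N := \matrix_(i, j)
  (Ex (fun w => \1_(in_phase J 0 i) w *
    (expR (- (c * slot_mean 0 w)) * (J h w == j)%:R)) / fine (P (in_phase J 0 i))).

Lemma Ex_slot_sample_cvg i cs j : all (fun c => 0 <= c) cs ->
  (fun r => Ex (fun w => \1_(in_phase J 0 i) w *
     (slot_weight (slot_sample r) 0 cs w * (J ((size cs)%:R * h) w == j)%:R)))
    @ \oo -->
  Ex (fun w => \1_(in_phase J 0 i) w *
     (slot_weight slot_mean 0 cs w * (J ((size cs)%:R * h) w == j)%:R)).
Proof.
move=> cs0; apply: (@bounded_Rintegral_cvg _ _ _ P _ measurableT PT _ _ 1) => //.
- move=> r; apply: measurable_funM; first by apply: measurable_indic; exact: Jm.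
  apply: measurable_funM.
    by apply: measurable_slot_weight => l; have [] := bounded_measurable_slot_sample r l.
  have [] // := bounded_measurable_phase JQ (fun k => (k == j)%:R)
    (mulr_ge0 (ler0n R (size cs)) (ltW h0)).
- move=> r w _; rewrite !normrM indicE; case: (w \in _); case: (_ == _);
    rewrite ?(normr0, normr1, mul0r, mulr0, mul1r, mulr1)// ger0_norm.
    by apply: slot_weight_le1 => // l; exact: slot_sample_ge0.
  exact: slot_weight_ge0.
- move=> w _; apply: cvgMr; apply: cvgMl; apply: slot_weight_cvg => l.
  exact: slot_sample_cvg.
Qed.

(** The instance of a single slot identifies the limit of the sampled matrices; limits of their
    products are then taken entrywise. *)
Lemma sample_step_cvg c i j : 0 <= c ->
  (fun r => sample_step r c i j) @ \oo --> slot_kernel c i j.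
Proof.
move=> c0; have p0 := initial_phase_gt0 i.
have -> : (fun r => sample_step r c i j) = (fun r =>
    Ex (fun w => \1_(in_phase J 0 i) w * (slot_weight (slot_sample r) 0 [:: c] w *
    (J (1%:R * h) w == j)%:R)) / fine (P (in_phase J 0 i))).
  apply/funext => r; rewrite (Ex_slot_sample r i [:: c] j) big_seq1.
  by rewrite mulrAC mulfV ?mul1r// gt_eqF.
have -> : slot_kernel c i j =
    Ex (fun w => \1_(in_phase J 0 i) w * (slot_weight slot_mean 0 [:: c] w *
    (J (1%:R * h) w == j)%:R)) / fine (P (in_phase J 0 i)).
  by rewrite mxE; congr (_ / _); apply: eq_Rintegral => w _ /=; rewrite mulr1 mul1r.
by apply: cvgMl; apply: (@Ex_slot_sample_cvg i [:: c] j); rewrite /= c0.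
Qed.

Lemma cvg_mx_prod (u : nat -> R -> 'M[R]_N) (v : R -> 'M[R]_N) cs i j :
  all (fun c => 0 <= c) cs ->
  (forall c i j, 0 <= c -> (fun r => u r c i j) @ \oo --> v c i j) ->
  (fun r => (\prod_(c <- cs) u r c) i j) @ \oo --> (\prod_(c <- cs) v c) i j.
Proof.
move=> + uv; elim: cs i => [|c cs IH] i /=.
  by move=> _; under eq_fun do rewrite big_nil; rewrite big_nil; exact: cvg_cst.
move=> /andP[c0 cs0]; under eq_fun do rewrite big_cons mxE; rewrite big_cons mxE.
apply: cvg_big => [|k _]; first exact: add_continuous.
by apply: cvgM; [exact: uv|exact: IH].
Qed.

(** For sampled means the product formula is exact, by the Markov property on the fine grid. Both
    sides converge as [r] grows, which transfers the factorisation to the path integrals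
    [slot_mean]. *)
Lemma Ex_slot_mean i cs j : all (fun c => 0 <= c) cs ->
  Ex (fun w => \1_(in_phase J 0 i) w * (slot_weight slot_mean 0 cs w *
    (J ((size cs)%:R * h) w == j)%:R)) =
  fine (P (in_phase J 0 i)) * (\prod_(c <- cs) slot_kernel c) i j.
Proof.
move=> cs0; have := @Ex_slot_sample_cvg i cs j cs0.
under eq_fun do rewrite Ex_slot_sample.
move/cvg_lim => <- //; apply/cvg_lim => //; apply: cvgMr.
by apply: cvg_mx_prod => // c k l; exact: sample_step_cvg.
Qed.

End slots.

(** * Patterns of empty and nonempty slots *)

Section passages.
Context d (Omega : measurableType d) (R : realType) (P : probability Omega R).
Context (N : nat) (Q : 'M[R]_N) (q : 'I_N -> R).
Context (J : R -> Omega -> 'I_N) (A : R -> Omega -> nat).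
Hypothesis q0 : forall i, 0 <= q i.
Hypothesis JQ : markov_chain P Q J.
Hypothesis J0 : forall i : 'I_N, (0 < P (in_phase J 0 i))%E.
Hypothesis AJ : modulated_poisson P q J A.
Variable h : R.
Hypothesis h0 : 0 < h.

Let Jm t i := @measurable_in_phase _ _ _ _ _ _ _ t i JQ.

Let Am t k := @measurable_count_eq _ _ _ _ _ _ _ _ t k AJ.

Local Notation Ex := (Rintegral P setT).
Local Notation pr E := (fine (P E)).

Let PT := probability_lty P measurableT.
Local Hint Resolve PT : core.

Lemma poisson_weight_ge0 (m : R) k : 0 <= m -> 0 <= poisson_weight m k.
Proof. by move=> m0; rewrite mulr_ge0 ?expR_ge0// divr_ge0// exprn_ge0. Qed.

Lemma nneseries_poisson_weight (m : R) : 0 <= m ->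
  (\sum_(0 <= k <oo) (poisson_weight m k)%:E = 1)%E.
Proof.
move=> m0; rewrite [RHS](_ : _ = (expR (- m))%:E * (expR m)%:E)%E; last first.
  by rewrite -EFinM expRN mulVf ?gt_eqF ?expR_gt0.
under eq_eseriesr do rewrite /poisson_weight EFinM muleC.
rewrite nneseriesZl; last by move=> k _; rewrite lee_fin divr_ge0// exprn_ge0.
congr (_ * _)%E; rewrite -EFin_lim; last exact: is_cvg_series_exp_coeff.
by apply/congr_lim/funext => n /=; rewrite -sumEFin.
Qed.

Definition slot_count l w := (A (l.+1%:R * h) w - A (l%:R * h) w)%N.

Lemma measurable_slot_count l (u : set nat) :
  measurable [set w | u (slot_count l w)].
Proof.
have -> : [set w | u (slot_count l w)] = \bigcup_(a in @setT nat)
    \bigcup_(b in [set b | u (a - b)%N])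
      ([set w | A (l.+1%:R * h) w = a] `&` [set w | A (l%:R * h) w = b]).
  apply/seteqP; split => w /=.
    by move=> uw; exists (A (l.+1%:R * h) w) => //; exists (A (l%:R * h) w).
  by move=> [a _ [b /= ub [ea eb]]]; rewrite /slot_count ea eb.
apply: bigcup_measurable => a _; apply: bigcup_measurable => b _.
by apply: measurableI; apply: Am; rewrite mulr_ge0// ltW.
Qed.

Fixpoint slots l (us : seq (set nat)) : set Omega :=
  if us is u :: us' then [set w | u (slot_count l w)] `&` slots l.+1 us'
  else setT.

Lemma measurable_slots l us : measurable (slots l us).
Proof.
elim: us l => //= u us IH l; apply: measurableI => //.
exact: measurable_slot_count.
Qed.

Lemma slots_cat l us vs :
  slots l (us ++ vs) = slots l us `&` slots (l + size us) vs.
Proof.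
elim: us l => [|u us IH] l /=; first by rewrite setTI addn0.
by rewrite IH setIA addSnnS.
Qed.

Definition exact_slots (ks : seq nat) : set Omega :=
  \bigcap_(l in [set l | (l < size ks)%N]) [set w | slot_count l w = nth 0%N ks l].

Lemma exact_slots_rcons ks k : exact_slots (rcons ks k) =
  exact_slots ks `&` [set w | slot_count (size ks) w = k].
Proof.
apply/seteqP; split => w.
  move=> H; split.
    by move=> l /= lk; have := H l; rewrite /= size_rcons nth_rcons lk => -> //; exact: ltnW.
  by have := H (size ks); rewrite /= size_rcons nth_rcons ltnn eqxx; exact.
move=> [H Hk] l /=; rewrite size_rcons nth_rcons ltnS leq_eqVlt.
by case: eqP => [->|_ /= lk]; rewrite ?ltnn// lk; exact: H.
Qed.

Lemma measurable_exact_slots ks : measurable (exact_slots ks).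
Proof.
apply: bigcap_measurableType => l _.
exact: (measurable_slot_count l [set nth 0%N ks l]).
Qed.

Definition poisson_slots ks w : R :=
  \prod_(l < size ks) poisson_weight (slot_mean q J h l w) (nth 0%N ks l).

Lemma poisson_slots_rcons ks k w : poisson_slots (rcons ks k) w =
  poisson_slots ks w * poisson_weight (slot_mean q J h (size ks) w) k.
Proof.
rewrite /poisson_slots size_rcons big_ord_recr/= nth_rcons ltnn eqxx.
by congr (_ * _); apply: eq_bigr => l _; rewrite nth_rcons ltn_ord.
Qed.

Lemma measurable_poisson_weight l k : measurable_fun setT
  (fun w => poisson_weight (slot_mean q J h l w) k).
Proof.
have mL := measurable_slot_mean q0 JQ h0 l; apply: measurable_funM.
  by apply: measurable_funM => //; exact: measurable_funX.
by apply: measurableT_comp => //; exact: measurableT_comp.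
Qed.

Lemma measurable_poisson_slots ks : measurable_fun setT (poisson_slots ks).
Proof.
by apply: measurable_prod => l _; exact: measurable_poisson_weight.
Qed.

Lemma poisson_slots_ge0 ks w : 0 <= poisson_slots ks w.
Proof.
by apply: prodr_ge0 => l _; apply: poisson_weight_ge0; exact: slot_mean_ge0.
Qed.

(* [true] stands for an empty slot and [false] for an unconstrained one. *)
Definition loose_slot b : set nat := if b then [set 0%N] else setT.

(** The law of [A] speaks of exact counts in all slots. Induction on [bs] fixes the count of the
    first loose slot and moves it into [ks]; an unconstrained slot is recovered by summing over its
    count, since Poisson weights add up to 1. *)
Lemma exact_loose_slots E ks bs : measurable E -> phase_events J E ->
  P (E `&` (exact_slots ks `&` slots (size ks) (map loose_slot bs))) =
  (\int[P]_(w in E) (poisson_slots ks w * slot_weight (slot_mean q J h)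
     (size ks) (map (fun b : bool => b%:R) bs) w)%:E)%E.
Proof.
move=> mE EJ; have mL := measurable_slot_mean q0 JQ h0.
have mW l cs := measurable_funTS (D := E) (measurable_slot_weight l cs mL).
have mp ks' := measurable_funTS (D := E) (measurable_poisson_slots ks').
elim: bs ks => [|b bs IH] ks /=.
  rewrite setIT; move: AJ => [_ _ _ law].
  have := @law E (size ks) (fun l => l%:R * h) (nth 0%N ks) EJ.
  rewrite mul0r => -> //; last by move=> l; rewrite ler_pM2r// ler_nat.
  apply: eq_integral => w _; rewrite mulr1 /poisson_slots; apply: (congr1 EFin).
  by apply: eq_bigr => l _; rewrite /slot_mean -[l.+1%:R]natr1 mulrDl mul1r.
case: b => /=.
  rewrite setIA [X in (_ `&` X) `&` _]/= setIA.
  (* An empty slot is an exact count 0, whose Poisson weight is the exponential factor of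
     [slot_weight]. *)
  have := IH (rcons ks 0%N).
  rewrite exact_slots_rcons size_rcons -!setIA => ->; apply: eq_integral => w _.
  rewrite poisson_slots_rcons; congr EFin.
  by rewrite /poisson_weight expr0 fact0 divr1 !mul1r mulrA.
(* An unconstrained slot is the disjoint union over its possible counts. *)
have -> : E `&` (exact_slots ks `&` ([set w | loose_slot false (slot_count (size ks) w)] `&`
      slots (size ks).+1 (map loose_slot bs))) =
    \bigcup_k (E `&` (exact_slots (rcons ks k) `&`
      slots (size (rcons ks k)) (map loose_slot bs))).
  apply/seteqP; split=> w.
    move=> [Ew [ew [_ sw]]]; exists (slot_count (size ks) w) => //.
    by rewrite exact_slots_rcons size_rcons.
  by move=> [k _]; rewrite exact_slots_rcons size_rcons => -[Ew [[ew _] sw]].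
rewrite measure_bigcup; last 2 first.
- move=> k _; apply: measurableI => //; apply: measurableI.
    exact: measurable_exact_slots.
  exact: measurable_slots.
- apply/trivIsetP => k k' _ _ /eqP kk'; apply/seteqP; split => // w.
  rewrite !exact_slots_rcons => -[[_ [[_ /= Hk] _]] [_ [[_ /= Hk'] _]]].
  by apply: kk'; rewrite -Hk -Hk'.
under eq_eseriesl do rewrite in_setT.
transitivity (\sum_(0 <= k <oo) \int[P]_(w in E) (poisson_slots (rcons ks k) w *
    slot_weight (slot_mean q J h) (size ks).+1 (map (fun b : bool => b%:R) bs) w)%:E)%E.
  by apply: eq_eseriesr => k _; rewrite /= IH size_rcons.
rewrite -integral_nneseries//; last 2 first.
- move=> k; apply/measurable_EFinP; apply: measurable_funM => //.
- by move=> k w _; rewrite lee_fin mulr_ge0 ?poisson_slots_ge0 ?slot_weight_ge0.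
apply: eq_integral => w _; rewrite mul0r oppr0 expR0 mul1r.
under eq_eseriesr => k _.
  rewrite poisson_slots_rcons mulrAC EFinM; over.
rewrite nneseriesZl; last first.
  by move=> k _; rewrite lee_fin poisson_weight_ge0// slot_mean_ge0.
by rewrite nneseries_poisson_weight ?mule1// slot_mean_ge0.
Qed.

Lemma phase_events_inI t t' i j : 0 <= t -> 0 <= t' ->
  phase_events J (in_phase J t i `&` in_phase J t' j).
Proof.
move=> t0 t'0; rewrite /phase_events; set G := [set E | _].
by apply: (@measurableI _ (g_sigma_algebraType G)); apply: sub_gen_smallest;
  [exists t, i|exists t', j].
Qed.

Lemma pr_loose_slots i bs j :
  pr (in_phase J 0 i `&` in_phase J ((size bs)%:R * h) j `&`
      slots 0 (map loose_slot bs)) =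
  pr (in_phase J 0 i) *
    (\prod_(b <- bs) slot_kernel P q J h (b : bool)%:R) i j.
Proof.
have L0 : 0 <= (size bs)%:R * h by rewrite mulr_ge0// ltW.
set E := in_phase J 0 i `&` _.
have mE : measurable E by apply: measurableI; exact: Jm.
have := exact_loose_slots [::] bs mE (phase_events_inI i j (lexx 0) L0).
have -> : exact_slots [::] = setT.
  by apply/seteqP; split => // w _ l.
rewrite setTI => ->; have cs0 : all (fun c : R => 0 <= c) (map (fun b : bool => b%:R) bs).
  by apply/allP => _ /mapP[b _ ->].
have := Ex_slot_mean q0 JQ J0 h0 i j cs0; rewrite big_map => <-.
rewrite -/(Rintegral _ _ _) Rintegral_mkcond size_map; apply: eq_Rintegral => w _.
rewrite /patch /poisson_slots big_ord0 mul1r indicE /E in_setI.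
case: (_ \in in_phase J 0 i); rewrite ?mul0r//= mul1r.
case: (boolP (w \in _)); first by rewrite inE /in_phase/= => ->; rewrite eqxx mulr1.
by rewrite notin_setE /in_phase/= => /eqP/negPf ->; rewrite mulr0.
Qed.

(* [true] stands for a slot during which a car passes and [false] for an empty one. *)
Definition pattern_slot b : set nat := if b then ~` [set 0%N] else [set 0%N].

Definition pattern_kernel (b : bool) : 'M[R]_N :=
  if b then slot_kernel P q J h 0 - slot_kernel P q J h 1
  else slot_kernel P q J h 1.

(** A nonempty slot is an unconstrained slot minus an empty one, on the side of events as well as in
    the definition of [pattern_kernel]; the product formula for loose slots is linear in each
    factor. *)
Lemma pr_pattern i bs j :
  pr (in_phase J 0 i `&` in_phase J ((size bs)%:R * h) j `&`
      slots 0 (map pattern_slot bs)) =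
  pr (in_phase J 0 i) * (\prod_(b <- bs) pattern_kernel b) i j.
Proof.
(* The prefix [cs] collects the slots that have already been replaced by loose ones. *)
suff H cs : pr (in_phase J 0 i `&` in_phase J ((size cs + size bs)%:R * h) j `&`
      slots 0 (map loose_slot cs ++ map pattern_slot bs)) =
    pr (in_phase J 0 i) * (\prod_(c <- cs) slot_kernel P q J h (c : bool)%:R *
      \prod_(b <- bs) pattern_kernel b) i j.
  by have := H [::]; rewrite big_nil mul1r.
elim: bs cs => [|b bs IH] cs.
  by rewrite big_nil mulr1 addn0 cats0 pr_loose_slots.
pose E := in_phase J 0 i `&` in_phase J ((size cs + (size bs).+1)%:R * h) j.
have IHc (c : bool) : pr (E `&`
      slots 0 (map loose_slot cs ++ loose_slot c :: map pattern_slot bs)) =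
    pr (in_phase J 0 i) * (\prod_(c <- cs) slot_kernel P q J h (c : bool)%:R *
      (slot_kernel P q J h c%:R * \prod_(b <- bs) pattern_kernel b)) i j.
  have := IH (rcons cs c); rewrite map_rcons cat_rcons size_rcons addSnnS => ->.
  by rewrite -cats1 big_cat big_seq1 mulrA.
(* The two encodings are opposite: an empty slot is [false] in a pattern and [true] among loose
   slots. *)
rewrite big_cons; case: b; last exact: (IHc true).
pose S c := slots 0 (map loose_slot cs ++ loose_slot c :: map pattern_slot bs).
transitivity (pr (E `&` S false) - pr (E `&` S true)); last first.
  have mulBE (X Y Z W : 'M[R]_N) k l :
      (X * ((Y - Z) * W)) k l = (X * (Y * W)) k l - (X * (Z * W)) k l.
    by rewrite mulrBl mulrBr mxE [X in _ + X]mxE.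
  by rewrite /S (IHc false) (IHc true) -mulrBr -mulBE.
rewrite [map _ (true :: _)]/= [size (_ :: _)]/=.
rewrite {}/S !slots_cat/= -/E; set S := slots 0 _; set S' := slots _ _.
set l := size _.
have mE : measurable E.
  by apply: measurableI; apply: Jm => //; rewrite mulr_ge0// ltW.
have mS : measurable S by exact: measurable_slots.
have mS' : measurable S' by exact: measurable_slots.
have mu u : measurable (E `&` (S `&` ([set w | u (slot_count l w)] `&` S'))).
  do 3 apply: measurableI => //; exact: measurable_slot_count.
(* The event with slot [l] unconstrained splits into its nonempty and empty parts, so subtracting
   the latter leaves the pattern with a car. *)
have -> : E `&` (S `&` ([set w | loose_slot false (slot_count l w)] `&` S')) =
    (E `&` (S `&` ([set w | pattern_slot true (slot_count l w)] `&` S'))) `|`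
    (E `&` (S `&` ([set w | loose_slot true (slot_count l w)] `&` S'))).
  apply/seteqP; split => w; last by move=> [|] [? [? [? ?]]].
  move=> [Ew [Sw [_ S'w]]]; have [k0|k0] := pselect (slot_count l w = 0%N).
    by right.
  by left.
rewrite measureU//; last first.
  apply/seteqP; split => // w [[_ [_ [/= k0 _]]] [_ [_ [/= k0' _]]]].
  exact: k0.
rewrite fineD ?fin_num_measure//; rewrite addrK//.
Qed.

End passages.

(** * The discretised service *)

Section first_quiet_window.
Context d (Omega : measurableType d) (R : realType) (P : probability Omega R).
Context (N : nat) (Q : 'M[R]_N) (q : 'I_N -> R).
Context (J : R -> Omega -> 'I_N) (A : R -> Omega -> nat).
Hypothesis q0 : forall i, 0 <= q i.
Hypothesis JQ : markov_chain P Q J.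
Hypothesis J0 : forall i : 'I_N, (0 < P (in_phase J 0 i))%E.
Hypothesis AJ : modulated_poisson P q J A.
Variable h : R.
Hypothesis h0 : 0 < h.
Variable n : nat.

Let Jm t i := @measurable_in_phase _ _ _ _ _ _ _ t i JQ.

Local Notation pr E := (fine (P E)).
Local Notation cnt := (slot_count A h).
Local Notation pat := (map pattern_slot).
Local Notation K := (pattern_kernel P q J h).

Definition quiet l : set Omega := slots A h l (pat (nseq n false)).

Lemma slots_quietP k l w :
  slots A h l (pat (nseq k false)) w <-> forall p, (p < k)%N -> cnt (l + p) w = 0%N.
Proof.
elim: k l => [|k IH] l //=; rewrite IH; split.
  by move=> [c0 cS] [|p]; rewrite ?addn0// ltnS -addSnnS; exact: cS.
move=> c; split; first by have := c 0%N; rewrite addn0; exact.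
by move=> p pk; rewrite addSnnS; exact: c.
Qed.

(* A service starting at the beginning of slot [l] ends at the beginning of slot
   [l + k + n]. *)
Definition stop l k : set Omega :=
  [set w | quiet (l + k) w /\ forall k', (k' < k)%N -> ~ quiet (l + k') w].

Lemma measurable_quiet l : measurable (quiet l).
Proof. exact: (measurable_slots AJ h0). Qed.

Lemma measurable_stop l k : measurable (stop l k).
Proof.
have -> : stop l k = quiet (l + k) `&`
    \bigcap_(k' in [set k' | (k' < k)%N]) ~` quiet (l + k').
  by apply/seteqP; split => w [? H]; split => // k'; exact: H.
apply: measurableI; first exact: measurable_quiet.
apply: bigcap_measurableType => k' _; apply: measurableC; exact: measurable_quiet.
Qed.

Lemma stop0 l : stop l 0 = slots A h l (pat (nseq n false)).
Proof.
by apply/seteqP; split => w; rewrite /stop /= addn0; [case|split].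
Qed.

Definition first_car p : seq bool := rcons (nseq p false) true.

Lemma slots_first_carP p l w : slots A h l (pat (first_car p)) w <->
  (forall p', (p' < p)%N -> cnt (l + p') w = 0%N) /\ cnt (l + p) w <> 0%N.
Proof.
rewrite /first_car -cats1 map_cat slots_cat size_map size_nseq.
split; first by move=> [/slots_quietP Hp [/= cp _]].
by move=> [/slots_quietP Hp cp]; split => //; split.
Qed.

(** When [p < n] and the first car falls in slot [l + p], every window starting at one of the slots
    [l] to [l + p] contains that slot. A stop therefore needs [p < k], and this guard also keeps the
    truncated subtraction [k - p.+1] exact. *)
Definition restart l k p : set Omega := if (p < k)%N then
  slots A h l (pat (first_car p)) `&` stop (l + p.+1) (k - p.+1) else set0.

(* If [k > 0] the first window fails, and the search starts afresh after its first
   nonempty slot. *)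
Lemma stop_decomp l k : (0 < k)%N -> stop l k = \bigcup_(p in `I_n) restart l k p.
Proof.
rewrite /restart => k0; apply/seteqP; split => w.
  move=> [/slots_quietP qk nq].
  have [p pn cp] : exists2 p, (p < n)%N & cnt (l + p) w != 0%N.
    apply: contrapT => H; apply: (nq 0%N k0); apply/slots_quietP => p pn.
    by rewrite addn0; apply/eqP; apply: contrapT => /negP cp; apply: H; exists p.
  have ex : exists p, (p < n)%N && (cnt (l + p) w != 0%N) by exists p; rewrite pn.
  case: (ex_minnP ex) => {p pn cp ex} p /andP[pn cp] pmin.
  (* Otherwise [k <= p < n], and the nonempty slot [l + p] would lie inside the quiet window
     starting at [l + k]. *)
  have pk : (p < k)%N.
    rewrite ltnNge; apply/negP => kp; move/eqP: cp; apply.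
    have := qk (p - k)%N; rewrite -addnA subnKC//; apply.
    by rewrite (leq_ltn_trans _ pn)// leq_subr.
  exists p => //=; rewrite pk; split.
    apply/slots_first_carP; split; last exact/eqP.
    move=> p' p'p; apply/eqP; apply: contraTT p'p => cp'; rewrite -leqNgt.
    have [p'n|np'] := ltnP p' n; first by apply: pmin; rewrite p'n.
    by rewrite (leq_trans _ np')// ltnW.
  split.
    by apply/slots_quietP; rewrite -addnA subnKC.
  move=> k' k'k; rewrite -addnA; apply: nq.
  by rewrite -ltn_subRL.
move=> [p /= pn]; case: ifP => // pk [/slots_first_carP[c0 cp] [qk nq]].
split; first by move: qk; rewrite /quiet -addnA subnKC.
move=> k' k'k; have [k'p|pk'] := leqP k' p.
  move=> /slots_quietP/(_ (p - k')%N); rewrite -addnA subnKC// => H.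
  by apply: cp; apply: H; rewrite (leq_ltn_trans _ pn)// leq_subr.
have := nq (k' - p.+1)%N; rewrite -addnA subnKC//; apply.
by rewrite ltn_sub2r// (leq_ltn_trans pk').
Qed.

Lemma restart_trivIset l k : trivIset setT (restart l k).
Proof.
apply/trivIsetP; move=> + + _ _; suff H p p' : (p < p')%N ->
    restart l k p `&` restart l k p' = set0.
  move=> p p'; rewrite neq_ltn => /orP[|] pp'; first exact: H.
  by rewrite setIC; exact: H.
move=> pp'; apply/seteqP; split => // w []; rewrite /restart.
case: ifP => // _ [/slots_first_carP[_ cp] _].
by case: ifP => // _ [/slots_first_carP[c0 _] _]; apply: cp; exact: c0.
Qed.

Definition stop_kernel k : 'M[R]_N := \matrix_(i, j)
  (pr (in_phase J 0 i `&` (in_phase J ((k + n)%:R * h) j `&` stop 0 k)) /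
   pr (in_phase J 0 i)).

(** The prescribed prefix [bs] is what closes the recursion: a failed window becomes a longer prefix
    followed by a fresh search with a smaller [k]. *)
Definition pattern_stop i bs k j : set Omega :=
  in_phase J 0 i `&` in_phase J ((size bs + (k + n))%:R * h) j `&`
    (slots A h 0 (pat bs) `&` stop (size bs) k).

Lemma pr_pattern_stop_rec i bs k j : pr (pattern_stop i bs k j) =
  (k == 0%N)%:R * (pr (in_phase J 0 i) * (\prod_(b <- bs ++ nseq n false) K b) i j)
  + \sum_(p < n) if (p < k)%N then
      pr (pattern_stop i (bs ++ first_car p) (k - p.+1) j) else 0.
Proof.
case: k => [|k].
  rewrite eqxx mul1r [X in _ + X]big1 ?addr0; last by [].
  rewrite /pattern_stop stop0.
  have := pr_pattern q0 JQ J0 AJ h0 i (bs ++ nseq n false) j.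
  by rewrite map_cat slots_cat size_cat size_nseq size_map.
rewrite mul0r add0r /pattern_stop stop_decomp//.
set E := in_phase J 0 i `&` _; set S := slots A h 0 _.
set F := restart (size bs) k.+1.
have mE : measurable E.
  by apply: measurableI; apply: Jm => //; rewrite mulr_ge0// ltW.
have mS : measurable S by exact: (measurable_slots AJ h0).
have mF p : measurable (F p).
  rewrite /F /restart; case: ifP => // _; apply: measurableI; last exact: measurable_stop.
  exact: (measurable_slots AJ h0).
rewrite setIA setI_bigcupr bigcup_mkord
  (@measure_bigsetU _ _ _ P (fun p => E `&` S `&` F p)); last 2 first.
- by move=> p; apply: measurableI => //; exact: measurableI.
- apply/trivIsetP => p p' _ _ pp'; apply/seteqP; split => // w [[_ Fp] [_ Fp']].
  have /trivIsetP/(_ p p' I I pp') := @restart_trivIset (size bs) k.+1.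
  by move=> /seteqP[+ _]; apply; split.
rewrite -sum_fine; last first.
  by move=> p _; apply: fin_num_measure; apply: measurableI => //; exact: measurableI.
apply: eq_bigr => p _; rewrite /F /restart.
case: ifP => pk; last by rewrite setI0 measure0.
rewrite /E /S map_cat slots_cat size_map size_cat size_rcons size_nseq.
rewrite -addnA [(p.+1 + _)%N]addnA subnKC//.
by rewrite -!setIA.
Qed.

Lemma pattern_stop_nil i k j : pr (pattern_stop i [::] k j) =
  pr (in_phase J 0 i) * stop_kernel k i j.
Proof.
rewrite mxE mulrCA mulfV ?mulr1 ?gt_eqF ?(initial_phase_gt0 JQ J0)//.
by rewrite /pattern_stop add0n setTI setIA.
Qed.

(** This is the regeneration property. By strong induction on [k], the recursion yields a right
    factor [G] that does not depend on the prefix [bs], and the empty prefix then identifies [G]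
    with [stop_kernel k]. *)
Lemma pr_pattern_stop i bs k j : pr (pattern_stop i bs k j) =
  pr (in_phase J 0 i) * (\prod_(b <- bs) K b * stop_kernel k) i j.
Proof.
have pr_neq0 i' : pr (in_phase J 0 i') != 0.
  by rewrite gt_eqF// (initial_phase_gt0 JQ J0).
elim/ltn_ind: k i bs j => k IH i bs j.
pose G : 'M[R]_N := (if k == 0%N then K false ^+ n else 0)
  + \sum_(p < n) if (p < k)%N then K false ^+ p * K true * stop_kernel (k - p.+1) else 0.
have first_carE p : \prod_(b <- first_car p) K b = K false ^+ p * K true.
  by rewrite /first_car -cats1 big_cat big_seq1 big_nseq iter_mulr_1.
have law i' bs' j' : pr (pattern_stop i' bs' k j') =
    pr (in_phase J 0 i') * (\prod_(b <- bs') K b * G) i' j'.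
  set Z := \prod_(b <- bs') K b; have ZG : (Z * G) i' j' =
      (k == 0%N)%:R * (Z * K false ^+ n) i' j' + \sum_(p < n) if (p < k)%N
        then (Z * (K false ^+ p * K true * stop_kernel (k - p.+1))) i' j' else 0.
    have addE (X Y : 'M[R]_N) : (X + Y) i' j' = X i' j' + Y i' j' by rewrite mxE.
    rewrite /G mulrDr addE mulr_sumr summxE; congr (_ + _).
      by case: eqP => _; rewrite ?mul1r// mul0r mulr0 mxE.
    by apply: eq_bigr => p _; case: ifP => // _; rewrite mulr0 mxE.
  rewrite pr_pattern_stop_rec ZG mulrDr mulrCA; congr (_ + _).
    by rewrite big_cat big_nseq iter_mulr_1.
  rewrite mulr_sumr; apply: eq_bigr => p _; case: ifP => pk; last by rewrite mulr0.
  rewrite IH; last by rewrite ltn_subrL (leq_ltn_trans _ pk).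
  by rewrite big_cat/= first_carE -[Z * _ * _]mulrA.
suff <- : G = stop_kernel k by exact: law.
apply/matrixP => i' j'; apply: (mulfI (pr_neq0 i')).
by rewrite -pattern_stop_nil law big_nil mul1r.
Qed.

End first_quiet_window.

Section complex_expectation.
Context d (Omega : measurableType d) (R : realType) (P : probability Omega R).
Implicit Types (B : set Omega) (f : Omega -> R[i]).

Lemma cintegral_sum B (I : Type) (r : seq I) (c : I -> R[i]) (f : I -> Omega -> R) :
  measurable B -> (forall i, bounded_measurable B (f i)) ->
  cintegral P B (fun w => \sum_(i <- r) c i * (f i w)%:C) =
  \sum_(i <- r) c i * (\int[P]_(w in B) f i w)%:C.
Proof.
move=> mB mf; have PB : (P B < +oo)%E.
  exact: probability_lty.
have mcf (g : R[i] -> R) i : bounded_measurable B (fun w => g (c i) * f i w).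
  by apply: bounded_measurableM => //; exact: bounded_measurable_cst.
apply/eqP; rewrite eq_complex complex_Re_sum complex_Im_sum /=; apply/andP; split; apply/eqP.
  transitivity (\int[P]_(w in B) \sum_(i <- r) complex.Re (c i) * f i w).
    apply: eq_Rintegral => w _; rewrite complex_Re_sum; apply: eq_bigr => i _.
    by rewrite complex_ReM /= mulr0 subr0.
  rewrite Rintegral_sum//; apply: eq_bigr => i _.
  by rewrite complex_ReM /= mulr0 subr0 RintegralZ.
transitivity (\int[P]_(w in B) \sum_(i <- r) complex.Im (c i) * f i w).
  apply: eq_Rintegral => w _; rewrite complex_Im_sum; apply: eq_bigr => i _.
  by rewrite complex_ImM /= mulr0 add0r.
rewrite Rintegral_sum//; apply: eq_bigr => i _.
by rewrite complex_ImM /= mulr0 add0r RintegralZ.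
Qed.

Lemma cond_expectation_cvg B (f_ : nat -> Omega -> R[i]) f :
  measurable B ->
  (forall n, measurable_fun setT (fun w => complex.Re (f_ n w))) ->
  (forall n, measurable_fun setT (fun w => complex.Im (f_ n w))) ->
  (forall n w, normc (f_ n w) <= 1) ->
  (forall w, ccvg \oo (f_ ^~ w) (f w)) ->
  ccvg \oo (fun n => cond_expectation P (f_ n) B) (cond_expectation P f B).
Proof.
move=> mB mRe mIm f1 ff; have PB : (P B < +oo)%E.
  exact: probability_lty.
apply: ccvgM; last exact: ccvg_cst.
split; rewrite /cintegral/=.
  apply: (@bounded_Rintegral_cvg _ _ _ P _ mB PB _ _ 1).
  - by move=> n; exact: measurable_funTS.
  - by move=> n w _; exact: le_trans (normc_ge_absRe _) (f1 n w).
  - by move=> w _; have [] := ff w.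
apply: (@bounded_Rintegral_cvg _ _ _ P _ mB PB _ _ 1).
- by move=> n; exact: measurable_funTS.
- by move=> n w _; exact: le_trans (normc_ge_absIm _) (f1 n w).
- by move=> w _; have [] := ff w.
Qed.

End complex_expectation.

(** * Transforms of the discretised service *)

Section window_transform.
Context d (Omega : measurableType d) (R : realType) (P : probability Omega R).
Context (N : nat) (Q : 'M[R]_N) (q : 'I_N -> R).
Context (J : R -> Omega -> 'I_N) (A : R -> Omega -> nat).
Hypothesis q0 : forall i, 0 <= q i.
Hypothesis JQ : markov_chain P Q J.
Hypothesis J0 : forall i : 'I_N, (0 < P (in_phase J 0 i))%E.
Hypothesis AJ : modulated_poisson P q J A.
Variable h : R.
Hypothesis h0 : 0 < h.
Variable n : nat.
Variable z : R[i].
Hypothesis z1 : normc z <= 1.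

Let Jm t i := @measurable_in_phase _ _ _ _ _ _ _ t i JQ.

Local Notation pr E := (fine (P E)).
Local Notation K := (pattern_kernel P q J h).
Local Notation stop := (stop A h n 0).
Local Notation stop_kernel := (stop_kernel P J A h n).

Lemma stop_kernel_rec k i j : stop_kernel k i j =
  (k == 0%N)%:R * (K false ^+ n) i j + \sum_(p < n) if (p < k)%N then
    (K false ^+ p * K true * stop_kernel (k - p.+1)) i j else 0.
Proof.
have Pi : pr (in_phase J 0 i) != 0 by rewrite gt_eqF// (initial_phase_gt0 JQ J0).
apply: (mulfI Pi); rewrite -(pattern_stop_nil A JQ J0).
rewrite (pr_pattern_stop_rec q0 JQ J0 AJ)// mulrDr [in RHS]mulrCA; congr (_ + _).
  by rewrite cat0s big_nseq iter_mulr_1.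
rewrite mulr_sumr; apply: eq_bigr => p _; case: ifP => pk; last by rewrite mulr0.
rewrite cat0s (pr_pattern_stop q0 JQ J0 AJ)//.
by rewrite /first_car -cats1 big_cat big_seq1 big_nseq iter_mulr_1.
Qed.

Lemma stop_unique k k' w : stop k w -> stop k' w -> k = k'.
Proof.
move=> [qk nk] [qk' nk']; apply/eqP; rewrite eqn_leq.
by apply/andP; split; rewrite leqNgt; apply/negP; move=> kk;
  [exact: (nk _ kk qk')|exact: (nk' _ kk qk)].
Qed.

(** The stopping index is chosen classically and is unique by [stop_unique]. A search that never
    ends has value 0, the same convention as for an infinite [service_time]. *)
Definition window_value j w : R[i] :=
  if pselect (exists k, stop k w) is left e then
    z ^+ (projT1 (cid e) + n) * ((J ((projT1 (cid e) + n)%:R * h) w == j)%:R : R)%:C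
  else 0.

(** Truncation at [M] leaves a finite sum of indicators, for which measurability and the expectation
    follow by linearity. Since the events [stop k] are disjoint, the modulus never exceeds 1. *)
Definition window_partial j M w : R[i] := \sum_(0 <= k < M)
  z ^+ (k + n) * (\1_(in_phase J ((k + n)%:R * h) j `&` stop k) w)%:C.

Lemma window_valueE j k w : stop k w -> window_value j w =
  z ^+ (k + n) * ((J ((k + n)%:R * h) w == j)%:R : R)%:C.
Proof.
move=> sk; rewrite /window_value; case: pselect => [e|]; last by case; exists k.
by case: cid => k' sk' /=; rewrite (stop_unique sk sk').
Qed.

Lemma window_partialE j M w : window_partial j M w =
  if `[< exists2 k, (k < M)%N & stop k w >] then window_value j w else 0.
Proof.
rewrite /window_partial big_mkord; case: asboolP => [[k kM sk]|nex].
  rewrite (bigD1 (Ordinal kM))//= big1 ?addr0 => [|k' /negP k'k].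
    rewrite (window_valueE _ sk); congr (_ * _%:C); rewrite indicE in_setI.
    rewrite (mem_set sk) andbT; congr (_ %:R); congr nat_of_bool.
    by apply/idP/eqP => [/set_mem//|Jj]; exact/mem_set.
  rewrite indicE memNset ?mulr0// => -[_ sk']; apply: k'k.
  by apply/eqP/val_inj; exact: (stop_unique sk' sk).
rewrite big1// => k _; rewrite indicE memNset ?mulr0// => -[_ sk].
by apply: nex; exists k.
Qed.

Lemma normc_expr_le1 k : normc (z ^+ k) <= 1.
Proof.
elim: k => [|k IH]; first by rewrite expr0 ComplexField.Normc.normc1.
by rewrite exprS ComplexField.Normc.normcM mulr_ile1// normc_ge0.
Qed.

Lemma normc_window_value j w : normc (window_value j w) <= 1.
Proof.
rewrite /window_value; case: pselect => [e|_]; last by rewrite ComplexField.Normc.normc0.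
rewrite ComplexField.Normc.normcM normc_real// mulr_ile1 ?normc_expr_le1//.
- by rewrite normc_ge0.
- by case: (_ == _).
Qed.

Lemma normc_window_partial j M w : normc (window_partial j M w) <= 1.
Proof.
rewrite window_partialE; case: ifP => _; first exact: normc_window_value.
by rewrite ComplexField.Normc.normc0.
Qed.

Lemma window_partial_ccvg j w :
  ccvg \oo (fun M => window_partial j M w) (window_value j w).
Proof.
apply: (@ccvg_near _ _ \oo _ (fun=> window_value j w)); last exact: ccvg_cst.
have [[k sk]|nex] := pselect (exists k, stop k w).
  exists k.+1 => // M /= kM; rewrite window_partialE.
  by rewrite (asboolT (ex_intro2 _ _ k _ sk)).
apply: nearW => M; rewrite window_partialE asboolF; last first.
  by move=> [k _ sk]; apply: nex; exists k.
by rewrite /window_value; case: pselect.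
Qed.

Lemma measurable_window_partial j M :
  measurable_fun setT (fun w => complex.Re (window_partial j M w)) /\
  measurable_fun setT (fun w => complex.Im (window_partial j M w)).
Proof.
have mI k : measurable_fun setT
    (\1_(in_phase J ((k + n)%:R * h) j `&` stop k) : Omega -> R).
  apply: measurable_indic; apply: measurableI.
    by apply: Jm; rewrite mulr_ge0// ltW.
  exact: (measurable_stop AJ h0).
split.
  have -> : (fun w => complex.Re (window_partial j M w)) = fun w => \sum_(0 <= k < M)
      complex.Re (z ^+ (k + n)) * \1_(in_phase J ((k + n)%:R * h) j `&` stop k) w.
    apply/funext => w /=; rewrite complex_Re_sum; apply: eq_bigr => k _.
    by rewrite complex_ReM /= mulr0 subr0.
  by apply: measurable_sum => k; apply: measurable_funM.
have -> : (fun w => complex.Im (window_partial j M w)) = fun w => \sum_(0 <= k < M)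
    complex.Im (z ^+ (k + n)) * \1_(in_phase J ((k + n)%:R * h) j `&` stop k) w.
  apply/funext => w /=; rewrite complex_Im_sum; apply: eq_bigr => k _.
  by rewrite complex_ImM /= mulr0 add0r.
by apply: measurable_sum => k; apply: measurable_funM.
Qed.

Lemma measurable_window_value j :
  measurable_fun setT (fun w => complex.Re (window_value j w)) /\
  measurable_fun setT (fun w => complex.Im (window_value j w)).
Proof.
split.
  apply: (measurable_fun_cvg (h := fun M w => complex.Re (window_partial j M w))).
    by move=> M; have [] := measurable_window_partial j M.
  by move=> w _; have [] := window_partial_ccvg j w.
apply: (measurable_fun_cvg (h := fun M w => complex.Im (window_partial j M w))).
  by move=> M; have [] := measurable_window_partial j M.
by move=> w _; have [] := window_partial_ccvg j w.
Qed.

Lemma cond_expectation_window_partial i j M :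
  cond_expectation P (window_partial j M) (in_phase J 0 i) =
  \sum_(0 <= k < M) z ^+ (k + n) * (stop_kernel k i j)%:C.
Proof.
have mi : measurable (in_phase J 0 i) by exact: Jm.
have mjk k : measurable (in_phase J ((k + n)%:R * h) j `&` stop k).
  apply: measurableI; first by apply: Jm; rewrite mulr_ge0// ltW.
  exact: (measurable_stop AJ h0).
rewrite /cond_expectation cintegral_sum//; last first.
  move=> k; split; first by apply: measurable_funTS; exact: measurable_indic.
  by exists 1 => w _; rewrite indicE; case: (_ \in _); rewrite ?normr0 ?normr1.
rewrite mulr_suml; apply: eq_bigr => k _; rewrite -mulrA; congr (_ * _).
rewrite -rmorphV /=; last by rewrite unitfE gt_eqF// (initial_phase_gt0 JQ J0).
rewrite -rmorphM; congr (_%:C); rewrite mxE; congr (_ / _).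
by rewrite /Rintegral integral_indic// setIC.
Qed.

Lemma sum_shift (V : nmodType) M p (F : nat -> V) :
  \sum_(0 <= k < M) (if (p < k)%N then F (k - p.+1)%N else 0) =
  \sum_(0 <= k < M - p.+1) F k.
Proof.
elim: M => [|M IH]; first by rewrite sub0n !big_geq.
rewrite big_nat_recr//= IH; case: ltnP => pM.
  by rewrite subSn// big_nat_recr.
have Mp : (M.+1 <= p.+1)%N by [].
by rewrite (eqP Mp) (eqP (leqW pM)) !big_geq// addr0.
Qed.

Local Notation W M i j := (cond_expectation P (window_partial j M) (in_phase J 0 i)).

(** This is the convolution equation for [stop_kernel], summed up to the truncation. The bound
    [M.+1] ensures that the term [k = 0], success of the first window, is present; a first car in
    slot [p] shortens the remaining sum by [p.+1]. *)
Lemma window_partial_rec i j M : W M.+1 i j =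
  z ^+ n * ((K false ^+ n) i j)%:C + \sum_(p < n) z ^+ p.+1 *
    \sum_k ((K false ^+ p * K true) i k)%:C * W (M.+1 - p.+1)%N k j.
Proof.
rewrite cond_expectation_window_partial.
transitivity (\sum_(0 <= k < M.+1)
    (z ^+ (k + n) * ((k == 0%N)%:R * (K false ^+ n) i j)%:C +
    \sum_(p < n) if (p < k)%N then z ^+ (k + n) *
     ((K false ^+ p * K true * stop_kernel (k - p.+1)) i j)%:C else 0)).
  apply: eq_bigr => k _; rewrite stop_kernel_rec rmorphD mulrDr; congr (_ + _).
  rewrite rmorph_sum mulr_sumr; apply: eq_bigr => p _.
  by case: ifP => // _; rewrite mulr0.
rewrite big_split /=; congr (_ + _).
  rewrite big_nat_recl//= big1 ?addr0 ?mul1r// => k _.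
  by rewrite mul0r mulr0.
rewrite exchange_big /=; apply: eq_bigr => p _.
apply: (etrans _ (etrans (sum_shift M.+1 p (fun k => z ^+ (k + p.+1 + n) *
     ((K false ^+ p * K true * stop_kernel k) i j)%:C)) _)).
  by apply: eq_bigr => k _; case: ifP => // pk; rewrite subnK.
under [in RHS]eq_bigr do rewrite cond_expectation_window_partial.
rewrite mulr_sumr; under [RHS]eq_bigr do rewrite mulr_sumr mulr_sumr.
rewrite exchange_big /=; apply: eq_bigr => k _.
rewrite mxE rmorph_sum mulr_sumr; apply: eq_bigr => l _.
by rewrite rmorphM addnAC exprD; ring.
Qed.

Definition window_transform i j :=
  cond_expectation P (window_value j) (in_phase J 0 i).

Lemma window_transform_cvg i j :
  ccvg \oo (fun M => W M i j) (window_transform i j).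
Proof.
apply: cond_expectation_cvg.
- exact: Jm.
- by move=> M; have [] := measurable_window_partial j M.
- by move=> M; have [] := measurable_window_partial j M.
- by move=> M w; exact: normc_window_partial.
- by move=> w; exact: window_partial_ccvg.
Qed.

(** The truncated equation is passed to the limit in [M]. The limits exist by bounded convergence on
    paths, which covers [normc z = 1] and paths on which the search never ends. *)
Lemma window_system i j : window_transform i j =
  z ^+ n * ((K false ^+ n) i j)%:C + \sum_k
    (\sum_(p < n) z ^+ p.+1 * ((K false ^+ p * K true) i k)%:C) * window_transform k j.
Proof.
have [ru iu] := window_transform_cvg i j.
have cS : ccvg \oo (fun M => W M.+1 i j) (window_transform i j).
  by split; [rewrite (cvg_shiftS (fun M => complex.Re (W M i j)))|
    rewrite (cvg_shiftS (fun M => complex.Im (W M i j)))].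
apply: ccvg_unique cS _.
under eq_fun do rewrite window_partial_rec.
apply: ccvgD; first exact: ccvg_cst.
under [X in ccvg _ _ X]eq_bigr do rewrite mulr_suml.
rewrite exchange_big /=; apply: ccvg_sum => p.
under [X in ccvg _ _ X]eq_bigr do rewrite -mulrA.
rewrite -mulr_sumr; apply: ccvgM; first exact: ccvg_cst.
apply: ccvg_sum => k; apply: ccvgM; first exact: ccvg_cst.
under eq_fun do rewrite subSS.
apply: (@ccvg_shift _ (fun M => W M k j)); exact: window_transform_cvg.
Qed.

End window_transform.

(** * Paths of the service *)

Section service_path.
Context d (Omega : measurableType d) (R : realType) (N : nat).
Context (J : R -> Omega -> 'I_N) (A : R -> Omega -> nat) (w : Omega).
Hypothesis Amono : forall a b : R, 0 <= a -> a <= b -> (A a w <= A b w)%N.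
Hypothesis Aright : forall t : R, 0 <= t -> \forall u \near t^'+, A u w = A t w.
Hypothesis Jright : forall t : R, 0 <= t -> \forall u \near t^'+, J u w = J t w.
Variable T : R.
Hypothesis T0 : 0 < T.

(* The service ends [T] after the first gap: that gap starts at an attempt, because
   the beginning of the level set of [A] through a gap is a gap as well. *)
Definition gap t := 0 <= t /\ A (t + T) w = A t w.

Lemma attempt_start_ge0 u : attempt_start A u w -> 0 <= u.
Proof. by move=> [->|[/ltW]]. Qed.

(** The witness is the infimum of the times at which the count equals [A t w]. Right-continuity
    shows that the count already has this value at the infimum, and at earlier times it is strictly
    smaller. *)
Lemma attempt_start_level t : 0 <= t ->
  exists2 u, attempt_start A u w & u <= t /\ A u w = A t w.
Proof.
move=> t0; pose S := [set v | 0 <= v /\ A v w = A t w].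
have St : S t by [].
have lbS : lbound S 0 by move=> v [].
have hS : has_inf S by split; [exists t|exists 0].
have u0 : 0 <= inf S by apply: lb_le_inf => //; exists t.
have ut : inf S <= t by apply: ge_inf => //; exists 0.
have ulb v : S v -> inf S <= v by move=> Sv; apply: ge_inf => //; exists 0.
have Au : A (inf S) w = A t w.
  have [e e0 He] := near_at_rightP (Aright u0).
  have [v [v0 Av]] := inf_adherent e0 hS.
  have := ulb _ (conj v0 Av); rewrite le_eqVlt => /predU1P[->//|uv ve].
  by rewrite -(He v uv ve).
exists (inf S) => //; have [->|un0] := eqVneq (inf S) 0; first by left.
right; split; first by rewrite lt_neqAle eq_sym un0.
move=> v v0 vu; rewrite ltn_neqAle (Amono v0 (ltW vu)) andbT.
by apply/eqP => vE; move: vu; rewrite ltNge ulb//; split => //; rewrite vE.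
Qed.

(** The least gap is found through the counts, which are well-ordered: take a gap with the smallest
    count and go back to the beginning of its level set. An earlier gap would have a smaller
    count. *)
Lemma service_time_min : (exists t, gap t) ->
  exists u, [/\ gap u, forall t, gap t -> u <= t & service_time A T w = (u + T)%:E].
Proof.
move=> [t1 gt1]; have ex : exists k, `[< exists2 t, gap t & A t w = k >].
  by exists (A t1 w); apply/asboolP; exists t1.
case: (ex_minnP ex) => k /asboolP[t gt Atk] kmin.
have [u au [ut Au]] := attempt_start_level gt.1.
have u0 := attempt_start_ge0 au.
have gu : gap u.
  split=> //; apply/eqP; have uT : u <= u + T by rewrite lerDl ltW.
  rewrite eqn_leq (Amono u0 uT) andbT Au -gt.2.
  by apply: Amono; rewrite ?lerD2r// addr_ge0// ltW.
have ulb t' : gap t' -> u <= t'.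
  move=> gt'; rewrite leNgt; apply/negP => t'u; case: au => [uE|[_ /(_ t' gt'.1 t'u)]].
    by move: t'u; rewrite uE ltNge gt'.1.
  rewrite Au Atk ltnNge => /negP; apply; apply: kmin.
  by apply/asboolP; exists t'.
exists u; split => //; apply/eqP; rewrite eq_le; apply/andP; split.
  by apply: ereal_inf_lbound; exists u => //; split => //; exact: gu.2.
apply: le_ereal_inf_tmp => _ [v [av Av] <-]; rewrite lee_fin lerD2r; apply: ulb.
by split => //; exact: attempt_start_ge0.
Qed.

Lemma service_time_pinfty : (forall t, ~ gap t) -> service_time A T w = +oo%E.
Proof.
move=> ng; rewrite /service_time [X in ereal_inf X](_ : _ = set0) ?ereal_inf0//.
apply/seteqP; split => // x [v [av Av] _]; apply: (ng v).
by split => //; exact: attempt_start_ge0.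
Qed.

Lemma slots_emptyP h l k : 0 <= h ->
  slots A h l (map pattern_slot (nseq k false)) w <->
  A ((l + k)%:R * h) w = A (l%:R * h) w.
Proof.
move=> h0; have mono a b : (a <= b)%N -> (A (a%:R * h) w <= A (b%:R * h) w)%N.
  by move=> ab; rewrite Amono ?mulr_ge0// ler_wpM2r// ler_nat.
split.
  move/slots_quietP; elim: k => [|k IH] H; first by rewrite addn0.
  rewrite -IH => [|p pk]; last by apply: H; rewrite ltnW.
  have /eqP := H k (ltnSn k); rewrite /slot_count subn_eq0 addnS => le.
  by apply/eqP; rewrite eqn_leq le mono.
move=> E; apply/slots_quietP => p pk; apply/eqP; rewrite /slot_count subn_eq0.
apply: (@leq_trans (A ((l + k)%:R * h) w)); first by apply: mono; rewrite -addnS leq_add2l.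
by rewrite E mono// leq_addr.
Qed.

Lemma mesh_mul n : n.+1%:R * (T / n.+1%:R) = T.
Proof. by rewrite mulrC divfK. Qed.

Lemma quiet_gap n l : quiet A (T / n.+1%:R) n.+1 l w <-> gap (l%:R * (T / n.+1%:R)).
Proof.
have h0 : 0 <= T / n.+1%:R by rewrite divr_ge0// ltW.
apply: (iff_trans (slots_emptyP _ _ h0)).
rewrite natrD mulrDl mesh_mul; split; last by case.
by split => //; rewrite mulr_ge0.
Qed.

Definition service_value (s : R[i]) j : R[i] :=
  if service_time A T w is g%:E
  then cexp (- s * g%:C) * ((J g w == j)%:R : R)%:C else 0.

Lemma cexp_expr (s : R[i]) (h : R) m :
  cexp (- s * h%:C) ^+ m = cexp (- s * (m%:R * h)%:C).
Proof.
elim: m => [|m IH]; first by rewrite expr0 mul0r mulr0 cexp0.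
by rewrite exprS IH -cexpD -mulrDr -rmorphD -[in RHS]natr1 mulrDl mul1r addrC.
Qed.

(** Let [u] be the least gap. No grid point before [u] is a gap, and by right-continuity at [u] and
    [u + T] the first grid point from [u] on is one as soon as the mesh is fine. The discretised
    service then ends less than one slot after the true one, in the same phase. *)
Lemma window_value_cvg (s : R[i]) j : ccvg \oo (fun n =>
  window_value J A (T / n.+1%:R) n.+1 (cexp (- s * (T / n.+1%:R)%:C)) j w)
  (service_value s j).
Proof.
have [exg|nog] := pselect (exists t, gap t); last first.
  rewrite /service_value service_time_pinfty; last by move=> t gt; apply: nog; exists t.
  apply: (@ccvg_near _ _ \oo _ (fun=> 0)); last exact: ccvg_cst.
  apply: nearW => n; rewrite /window_value; case: pselect => // ex; exfalso.
  case: ex => k [/quiet_gap gk _]; apply: nog.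
  by exists ((0 + k)%:R * (T / n.+1%:R)).
have [u [[u0 gu] umin uE]] := service_time_min exg.
rewrite /service_value uE.
have [e1 e10 He1] := near_at_rightP (Aright u0).
have uT0 : 0 <= u + T by rewrite addr_ge0// ltW.
have [e2 e20 He2] := near_at_rightP (Aright uT0).
have [e3 e30 He3] := near_at_rightP (Jright uT0).
have h0 n : 0 < T / n.+1%:R by rewrite divr_gt0.
(* [k n] is the index of the first grid point that is at least [u]; its minimality gives the
   distance of less than one slot. *)
have /choice[k Hk] n : exists k : nat, [/\ u <= k%:R * (T / n.+1%:R),
    k%:R * (T / n.+1%:R) < u + T / n.+1%:R &
    forall k', (k' < k)%N -> k'%:R * (T / n.+1%:R) < u].
  have ex : exists k : nat, u <= k%:R * (T / n.+1%:R).
    exists (Num.truncn (u / (T / n.+1%:R))).+1; rewrite -ler_pdivrMr//.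
    by rewrite ltW// truncnS_gt.
  case: (ex_minnP ex) => k uk kmin.
  have kmin' k' : (k' < k)%N -> k'%:R * (T / n.+1%:R) < u.
    by move=> k'k; rewrite ltNge; apply/negP => /kmin; rewrite leqNgt k'k.
  exists k; split => //; case: k uk kmin kmin' => [|k] uk _ kmin'.
    by rewrite mul0r ltr_wpDl.
  by rewrite -natr1 mulrDl mul1r ltrD2r kmin'.
pose v n := (k n)%:R * (T / n.+1%:R).
have vu : v @ \oo --> u.
  apply/cvgrPdist_lt => e e0; near=> n; have [uk ku _] := Hk n.
  rewrite distrC ger0_norm ?subr_ge0// ltrBlDl (lt_trans ku)// ltrD2l.
  by near: n; exact: near_mesh_lt.
(* For large [n] the phase at the end is already [J (u + T) w], so that only the exponent still
   varies. *)
apply: (@ccvg_near _ _ \oo _ (fun n => cexp (- s * (v n + T)%:C) *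
    ((J (u + T) w == j)%:R : R)%:C)); last first.
  apply: ccvgM; last exact: ccvg_cst.
  apply: cexp_ccvg; apply: ccvgM; first exact: ccvg_cst.
  by apply: ccvg_real; apply: cvgD => //; exact: cvg_cst.
near=> n; have [uk ku kmin] := Hk n; rewrite -/(v n) in uk ku.
have he1 : T / n.+1%:R < e1 by near: n; exact: near_mesh_lt.
have he2 : T / n.+1%:R < e2 by near: n; exact: near_mesh_lt.
have he3 : T / n.+1%:R < e3 by near: n; exact: near_mesh_lt.
have AE : A (v n) w = A u w.
  move: uk; rewrite le_eqVlt => /predU1P[<-//|uv]; apply: He1 => //.
  by rewrite (lt_trans ku)// ltrD2l.
have ATE : A (v n + T) w = A (u + T) w.
  move: uk; rewrite le_eqVlt => /predU1P[<-//|uv]; apply: He2; first by rewrite ltrD2r.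
  by rewrite addrAC ltrD2r (lt_trans ku)// ltrD2l.
have JTE : J (v n + T) w = J (u + T) w.
  move: uk; rewrite le_eqVlt => /predU1P[<-//|uv]; apply: He3; first by rewrite ltrD2r.
  by rewrite addrAC ltrD2r (lt_trans ku)// ltrD2l.
have sk : stop A (T / n.+1%:R) n.+1 0 (k n) w.
  split; first by apply/quiet_gap; split; [exact: le_trans uk|rewrite ATE AE].
  move=> k' k'k /quiet_gap/umin; rewrite leNgt => /negP; apply.
  exact: kmin.
rewrite (window_valueE _ _ _ sk) cexp_expr natrD mulrDl mesh_mul -/(v n).
by rewrite JTE.
Unshelve. all: by end_near. Qed.

End service_path.

(** * Vanishing mesh *)

(** Both bounds of the squeeze come from [1 + x <= expR x]: applied to the negative of
    [T / n.+1%:R * r] it gives the upper bound [r], and applied to that number itself the lower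
    bound. *)
Lemma one_sub_expRN_ratio_cvg (R : realType) (T r : R) : 0 < T -> 0 <= r ->
  (1 - expR (- (T / n.+1%:R * r))) / (T / n.+1%:R) @[n --> \oo] --> r.
Proof.
move=> T0 r0; have h0 n : 0 < T / n.+1%:R by rewrite divr_gt0.
have hr n : 0 <= T / n.+1%:R * r by rewrite mulr_ge0// ltW.
have h_cvg : T / n.+1%:R @[n --> \oo] --> 0.
  apply/cvgrPdist_lt => e e0; near=> n.
  rewrite sub0r normrN ger0_norm ?ltW//.
  by near: n; exact: near_mesh_lt.
apply: (@squeeze_cvgr _ _ _ _ (fun n => r / (1 + T / n.+1%:R * r)) (fun=> r)).
- apply: nearW => n; apply/andP; split; last first.
    rewrite ler_pdivrMr// mulrC lerBlDl -lerBlDr; exact: expR_ge1Dx.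
  rewrite ler_pdivlMr// mulrAC ler_pdivrMr ?ltr_pwDl// mulrC.
  have := expR_ge1Dx (T / n.+1%:R * r); set x := T / n.+1%:R * r => xe.
  rewrite mulrBl mul1r lerBrDr addrC lerD2r.
  by rewrite expRN mulrC ler_pdivrMr ?expR_gt0// mul1r.
- rewrite -[X in _ --> X]divr1; apply: cvgMr; apply: cvgV; first exact: oner_neq0.
  rewrite -[X in _ --> X]addr0; apply: cvgD; first exact: cvg_cst.
  by rewrite -(mul0r r); apply: cvgMl.
- exact: cvg_cst.
Unshelve. all: by end_near. Qed.

Lemma riemann_sum_ccvg (R : realType) (T : R) (G : R -> R[i]) (C : R) : 0 < T ->
  (forall t, 0 <= t -> t <= T -> normc (G t) <= C) ->
  (forall t, 0 <= t -> t < T -> ccvg t^'+ G (G t)) ->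
  ccvg \oo (fun n => \sum_(p < n.+1)
      (T / n.+1%:R)%:C * G (p.+1%:R * (T / n.+1%:R)))
    (cintegral lebesgue_measure `[0, T] G).
Proof.
move=> T0 GC Gr; split.
- have -> : (fun n => complex.Re (\sum_(p < n.+1)
      (T / n.+1%:R)%:C * G (p.+1%:R * (T / n.+1%:R)))) =
    (fun n => \sum_(p < n.+1)
      T / n.+1%:R * complex.Re (G (0 + p.+1%:R * (T / n.+1%:R)))).
    apply/funext => n; rewrite complex_Re_sum; apply: eq_bigr => p _.
    by rewrite complex_ReM /= mul0r subr0 add0r.
  have := @right_riemann_sum_cvg R (fun t => complex.Re (G t)) 0 T C T0.
  rewrite add0r; apply.
    by move=> t t0 tT; rewrite (le_trans (normc_ge_absRe _))// GC.
  by move=> t t0 tT; have [] := Gr t t0 tT.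
- have -> : (fun n => complex.Im (\sum_(p < n.+1)
      (T / n.+1%:R)%:C * G (p.+1%:R * (T / n.+1%:R)))) =
    (fun n => \sum_(p < n.+1)
      T / n.+1%:R * complex.Im (G (0 + p.+1%:R * (T / n.+1%:R)))).
    apply/funext => n; rewrite complex_Im_sum; apply: eq_bigr => p _.
    by rewrite complex_ImM /= mul0r addr0 add0r.
  have := @right_riemann_sum_cvg R (fun t => complex.Im (G t)) 0 T C T0.
  rewrite add0r; apply.
    by move=> t t0 tT; rewrite (le_trans (normc_ge_absIm _))// GC.
  by move=> t t0 tT; have [] := Gr t t0 tT.
Qed.

Section mesh_limit.
Context d (Omega : measurableType d) (R : realType) (P : probability Omega R).
Context (N : nat) (Q : 'M[R]_N) (q : 'I_N -> R).
Context (J : R -> Omega -> 'I_N) (A : R -> Omega -> nat).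
Hypothesis q0 : forall i, 0 <= q i.
Hypothesis JQ : markov_chain P Q J.
Hypothesis J0 : forall i : 'I_N, (0 < P (in_phase J 0 i))%E.
Hypothesis AJ : modulated_poisson P q J A.

Let Jm t i := @measurable_in_phase _ _ _ _ _ _ _ t i JQ.

Let Jr w t := @phase_right_cst _ _ _ _ _ _ _ w t JQ.

Let Am t k := @measurable_count_eq _ _ _ _ _ _ _ _ t k AJ.

Let A00 w := @count0 _ _ _ _ _ _ _ _ w AJ.

Let Amono w a b := @count_mono _ _ _ _ _ _ _ _ w a b AJ.

Let Ar w t := @count_right_cst _ _ _ _ _ _ _ _ w t AJ.

Local Notation Ex := (Rintegral P setT).
Local Notation pr E := (fine (P E)).
Local Notation bm := (bounded_measurable (@setT Omega)).
Local Notation phi := (no_car_phase P J A).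

Let PT := probability_lty P measurableT.
Local Hint Resolve PT : core.

Let Pi_gt0 i : 0 < pr (in_phase J 0 i).
Proof. exact: initial_phase_gt0 JQ J0 i. Qed.

(** By monotonicity of counts, the first [m] slots are all empty exactly when the count at
    [m%:R * h] is still its initial value 0. *)
Lemma pattern_kernel_expr h m i j : 0 < h ->
  (pattern_kernel P q J h false ^+ m) i j = phi (m%:R * h) i j.
Proof.
move=> h0; apply: (mulfI (lt0r_neq0 (Pi_gt0 i))).
have := pr_pattern q0 JQ J0 AJ h0 i (nseq m false) j.
rewrite big_nseq iter_mulr_1 size_nseq => <-.
rewrite /no_car_phase /cond_prob mulrCA mulfV ?lt0r_neq0// mulr1.
congr (fine (P _)); apply/seteqP; split=> w.
  move=> [[Ji Jj] /(slots_emptyP (@Amono w) _ _ (ltW h0))].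
  by rewrite add0n mul0r A00.
move=> [[A0 Jj] Ji]; split; first by split.
apply/(slots_emptyP (@Amono w) _ _ (ltW h0)).
by rewrite add0n mul0r A00.
Qed.

Lemma no_car_phase_ge0 t i j : 0 <= phi t i j.
Proof. by rewrite divr_ge0// fine_ge0. Qed.

Let measurable_no_car t j : 0 <= t ->
  measurable ([set w | A t w = 0%N] `&` in_phase J t j).
Proof. by move=> t0; apply: measurableI; [exact: Am|exact: Jm]. Qed.

Lemma no_car_phase_le1 t i j : 0 <= t -> phi t i j <= 1.
Proof.
move=> t0; rewrite ler_pdivrMr// mul1r.
have mi := Jm i (lexx 0).
have mI : measurable ([set w | A t w = 0%N] `&` in_phase J t j `&` in_phase J 0 i).
  by apply: measurableI => //; exact: measurable_no_car.
rewrite fine_le ?fin_num_measure//; apply: le_measure; rewrite ?inE//.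
Qed.

(** On each path both the count and the phase are constant just after [t], so the indicator is
    eventually constant along any sequence decreasing to [t]; bounded convergence does the rest. *)
Lemma no_car_phase_right_cvg t i j : 0 <= t ->
  phi u i j @[u --> t^'+] --> phi t i j.
Proof.
move=> t0; apply/cvg_at_rightP => u [ut u_cvg].
have u0 n : 0 <= u n by rewrite (le_trans t0)// ltW.
have mi := Jm i (lexx 0).
have phiE v : 0 <= v -> phi v i j = (\int[P]_(w in in_phase J 0 i)
    \1_([set w | A v w = 0%N] `&` in_phase J v j) w) / pr (in_phase J 0 i).
  move=> v0; rewrite /no_car_phase /cond_prob /Rintegral integral_indic//.
  exact: measurable_no_car.
rewrite phiE//; under eq_fun do rewrite phiE//.
apply: cvgMl; have PB : (P (in_phase J 0 i) < +oo)%E.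
  exact: probability_lty.
apply: (@bounded_Rintegral_cvg _ _ _ P _ mi PB _ _ 1).
- by move=> n; apply: measurable_funTS; apply: measurable_indic; exact: measurable_no_car.
- by move=> n w _; rewrite indicE; case: (_ \in _); rewrite ?normr0 ?normr1.
move=> w _; have [e1 e10 He1] := near_at_rightP (Ar w t0).
have [e2 e20 He2] := near_at_rightP (Jr w t0).
apply: cvg_near_cst; near=> n.
have ue1 : u n < t + e1.
  by near: n; apply: (cvgr_lt t) => //; rewrite ltrDl.
have ue2 : u n < t + e2.
  by near: n; apply: (cvgr_lt t) => //; rewrite ltrDl.
rewrite !indicE; congr (_%:R); congr nat_of_bool.
apply/idP/idP; rewrite !inE /in_phase /= => -[].
  by rewrite He1// He2.
by rewrite -(He1 (u n))// -(He2 (u n)).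
Unshelve. all: by end_near. Qed.

End mesh_limit.

(** * The limit system and uniqueness of its solution *)

Section renewal_limit.
Context d (Omega : measurableType d) (R : realType) (P : probability Omega R).
Context (N : nat) (Q : 'M[R]_N) (q : 'I_N -> R).
Context (J : R -> Omega -> 'I_N) (A : R -> Omega -> nat).
Hypothesis q0 : forall i, 0 <= q i.
Hypothesis JQ : markov_chain P Q J.
Hypothesis J0 : forall i : 'I_N, (0 < P (in_phase J 0 i))%E.
Hypothesis AJ : modulated_poisson P q J A.
Variable T : R.
Hypothesis T0 : 0 < T.
Variable s : R[i].
Hypothesis s0 : 0 <= complex.Re s.

Let Jm t i := @measurable_in_phase _ _ _ _ _ _ _ t i JQ.

Let Jr w t := @phase_right_cst _ _ _ _ _ _ _ w t JQ.

Let Amono w a b := @count_mono _ _ _ _ _ _ _ _ w a b AJ.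

Let Ar w t := @count_right_cst _ _ _ _ _ _ _ _ w t AJ.

Local Notation Ex := (Rintegral P setT).
Local Notation pr E := (fine (P E)).
Local Notation bm := (bounded_measurable (@setT Omega)).
Local Notation phi := (no_car_phase P J A).
Local Notation K := (pattern_kernel P q J).

Let PT := probability_lty P measurableT.
Local Hint Resolve PT : core.

Let Pi_gt0 i : 0 < pr (in_phase J 0 i).
Proof. exact: initial_phase_gt0 JQ J0 i. Qed.

Let bm_phase0 i : bm (\1_(in_phase J 0 i) : _ -> R).
Proof. by apply: bounded_measurable_indic; exact: Jm. Qed.

Let bm_phase_eq t j : 0 <= t -> bm (fun w => (J t w == j)%:R : R).
Proof.
by move=> t0; exact: (bounded_measurable_phase JQ (fun k => (k == j)%:R) t0).
Qed.

Let bm_slot_exp h c l : 0 < h -> 0 <= c ->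
  bm (fun w => expR (- (c * slot_mean q J h l w))).
Proof.
move=> h0 c0; split.
  apply: measurableT_comp => //; apply: measurableT_comp => //.
  apply: measurable_funM; first exact: measurable_cst.
  exact: (measurable_slot_mean q0 JQ h0 l).
exists 1 => w _; rewrite ger0_norm ?expR_ge0//.
by rewrite -expR0 ler_expR oppr_le0 mulr_ge0// slot_mean_ge0.
Qed.

Let bm_kernel h c i j : 0 < h -> 0 <= c -> bm (fun w => \1_(in_phase J 0 i) w *
  (expR (- (c * slot_mean q J h 0 w)) * (J h w == j)%:R)).
Proof.
move=> h0 c0; apply: bounded_measurableM => //.
apply: bounded_measurableM => //; first exact: bm_slot_exp.
by apply: bm_phase_eq; exact: ltW.
Qed.

Lemma pattern_kernel_trueE h i j : 0 < h -> K h true i j =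
  Ex (fun w => \1_(in_phase J 0 i) w *
    ((1 - expR (- slot_mean q J h 0 w)) * (J h w == j)%:R)) / pr (in_phase J 0 i).
Proof.
move=> h0; rewrite /pattern_kernel mxE [X in _ + X]mxE !mxE -mulrBl.
rewrite -RintegralB//; last 2 first.
- by apply: bounded_measurable_integrable => //; exact: bm_kernel.
- by apply: bounded_measurable_integrable => //; exact: bm_kernel.
congr (_ / _); apply: eq_Rintegral => w _.
by rewrite mul0r oppr0 expR0 [1 * slot_mean _ _ _ _ _]mul1r -mulrBr -mulrBl.
Qed.

Lemma sum_phase (f : 'I_N -> R) (k : 'I_N) : \sum_j f j * (k == j)%:R = f k.
Proof.
rewrite (bigD1 k)//= eqxx mulr1 big1 ?addr0// => j jk.
by rewrite eq_sym (negPf jk) mulr0.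
Qed.

Lemma slot_kernel_sum h c i : 0 < h -> 0 <= c ->
  \sum_j slot_kernel P q J h c i j =
  Ex (fun w => \1_(in_phase J 0 i) w * expR (- (c * slot_mean q J h 0 w))) /
    pr (in_phase J 0 i).
Proof.
move=> h0 c0; under eq_bigr do rewrite mxE.
rewrite -mulr_suml -Rintegral_sum//; last by move=> j; exact: bm_kernel.
congr (_ / _); apply: eq_Rintegral => w _.
by rewrite -mulr_sumr (sum_phase (fun=> _)).
Qed.

Lemma slot_kernel0_sum h i : 0 < h -> \sum_j slot_kernel P q J h 0 i j = 1.
Proof.
move=> h0; rewrite slot_kernel_sum//; apply: (canLR (mulfK (lt0r_neq0 (Pi_gt0 i)))).
rewrite mul1r -[RHS](Ex_indic P); last exact: Jm.
by apply: eq_Rintegral => w _; rewrite mul0r oppr0 expR0 mulr1.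
Qed.

(** All rates are at most [\sum_k q k], so given the phases an interval of length [T] is free of
    cars with probability at least [expR (- (T * \sum_k q k))]. The whole interval is treated as one
    slot. *)
Lemma no_car_sum_gt0 i : 0 < \sum_j phi T i j.
Proof.
have -> : \sum_j phi T i j = \sum_j slot_kernel P q J T 1 i j.
  apply: eq_bigr => j _; have := pattern_kernel_expr q0 JQ J0 AJ 1 i j T0.
  by rewrite expr1 mul1r => <-.
rewrite slot_kernel_sum// divr_gt0//.
apply: (@lt_le_trans _ _ (Ex (fun w => expR (- (T * \sum_k q k)) *
    \1_(in_phase J 0 i) w))).
  by rewrite RintegralZ// Ex_indic ?mulr_gt0 ?expR_gt0//; exact: Jm.
apply: le_Rintegral => //.
- apply: bounded_measurable_integrable => //; apply: bounded_measurableM => //.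
  exact: bounded_measurable_cst.
- apply: bounded_measurable_integrable => //; apply: bounded_measurableM => //.
  exact: bm_slot_exp.
- move=> w _; rewrite mulrC ler_wpM2l// ?indicE//.
  by rewrite ler_expR lerN2 mul1r; exact: (slot_mean_le q0 JQ T0).
Qed.

Lemma pattern_kernel_ge0 b h i j : 0 < h -> 0 <= K h b i j.
Proof.
move=> h0; case: b.
  rewrite pattern_kernel_trueE// divr_ge0//; last exact: ltW.
  apply: Rintegral_ge0 => w _; rewrite mulr_ge0 ?indicE// mulr_ge0//.
  by rewrite subr_ge0 -expR0 ler_expR oppr_le0 slot_mean_ge0.
rewrite mxE divr_ge0//; last exact: ltW.
by apply: Rintegral_ge0 => w _; rewrite mulr_ge0 ?indicE// mulr_ge0 ?expR_ge0.
Qed.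

(** The sum telescopes: [K h true + K h false] is the transition matrix [slot_kernel P q J h 0],
    whose rows sum to 1, so the row sums for a first car in slot [p] are differences of consecutive
    survival probabilities. *)
Lemma first_car_sum h i m : 0 < h ->
  \sum_(p < m) \sum_k (K h false ^+ p * K h true) i k
  = 1 - \sum_k (K h false ^+ m) i k.
Proof.
move=> h0; have KE p : \sum_k (K h false ^+ p * K h true) i k =
    \sum_k (K h false ^+ p) i k - \sum_k (K h false ^+ p.+1) i k.
  rewrite exprSr -sumrB; under eq_bigr do rewrite mxE.
  under [RHS]eq_bigr do rewrite [X in _ - X]mxE.
  rewrite sumrB exchange_big/= [X in _ = _ - X]exchange_big/= -sumrB.
  apply: eq_bigr => l _; rewrite -!mulr_sumr -[X in _ = X - _]mulr1 -mulrBr.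
  congr (_ * _); rewrite -(slot_kernel0_sum l h0) -sumrB; apply: eq_bigr => k _.
  by rewrite /pattern_kernel mxE [X in _ + X]mxE.
elim: m => [|m IH].
  rewrite big_ord0 expr0 (eq_bigr (fun k => 1 * (i == k)%:R)); last first.
    by move=> k _; rewrite mxE mul1r.
  by rewrite (sum_phase (fun=> 1)) subrr.
by rewrite big_ord_recr /= IH KE; ring.
Qed.

Let mesh n := T / n.+1%:R.
Let mesh_gt0 n : 0 < mesh n. Proof. by rewrite divr_gt0. Qed.

(** Each path keeps its initial phase for a positive time. On a short enough first slot the mean is
    therefore exactly [mesh n * q (J 0 w)], and the phase at the end of the slot is still the
    initial one, which makes the limit diagonal. *)
Lemma passage_rate_cvg i j :
  K (mesh n) true i j / mesh n @[n --> \oo] --> (i == j)%:R * q j.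
Proof.
have -> : (fun n => K (mesh n) true i j / mesh n) = (fun n =>
    Ex (fun w => \1_(in_phase J 0 i) w *
      ((1 - expR (- slot_mean q J (mesh n) 0 w)) / mesh n * (J (mesh n) w == j)%:R)) /
    pr (in_phase J 0 i)).
  apply/funext => n; rewrite pattern_kernel_trueE// mulrAC; congr (_ / _).
  rewrite -RintegralZr//.
    by apply: eq_Rintegral => w _; rewrite mulrA mulrA mulrAC -!mulrA [_^-1 * _]mulrC.
  apply: bounded_measurable_integrable => //; apply: bounded_measurableM => //.
  apply: bounded_measurableM => //; last by apply: bm_phase_eq; exact: ltW.
  apply: bounded_measurableB => //; first exact: bounded_measurable_cst.
  have := @bm_slot_exp (mesh n) 1 0 (mesh_gt0 n) ler01.
  by under eq_fun do rewrite mul1r.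
have -> : (i == j)%:R * q j =
    Ex (fun w => \1_(in_phase J 0 i) w * (q (J 0 w) * (J 0 w == j)%:R)) /
    pr (in_phase J 0 i).
  apply: (canRL (mulfK (lt0r_neq0 (Pi_gt0 i)))).
  transitivity (Ex (fun w => (i == j)%:R * q j * \1_(in_phase J 0 i) w)).
    by rewrite RintegralZ// Ex_indic//; exact: Jm.
  apply: eq_Rintegral => w _; rewrite indicE.
  case: (boolP (w \in _)); rewrite ?mulr0 ?mul0r// inE /in_phase /= => ->.
  by case: eqP => [->|_]; rewrite !(mul1r, mulr1, mul0r, mulr0).
apply: cvgMl.
(* The dominating constant comes from [1 - expR (- x) <= x] and from the bound of the slot mean by
   [mesh n * \sum_k q k]. *)
apply: (@bounded_Rintegral_cvg _ _ _ P _ measurableT PT _ _ (\sum_k q k)).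
- move=> n; apply: measurable_funM; first by have [] := bm_phase0 i.
  apply: measurable_funM; last by have [] := bm_phase_eq j (ltW (mesh_gt0 n)).
  apply: measurable_funM => //; apply: measurable_funB => //.
  apply: measurableT_comp => //; apply: measurableT_comp => //.
  exact: (measurable_slot_mean q0 JQ (mesh_gt0 n) 0).
- move=> n w _; set x := slot_mean _ _ _ _ _.
  have x0 : 0 <= x by exact: slot_mean_ge0.
  have r0 : 0 <= (1 - expR (- x)) / mesh n.
    by rewrite divr_ge0 ?subr_ge0 ?(ltW (mesh_gt0 n))// -expR0 ler_expR oppr_le0.
  have rq : (1 - expR (- x)) / mesh n <= \sum_k q k.
    rewrite ler_pdivrMr// mulrC.
    apply: le_trans (slot_mean_le q0 JQ (mesh_gt0 n) 0%N w).
    by rewrite -/x lerBlDl -lerBlDr; exact: expR_ge1Dx.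
  rewrite indicE; case: (_ \in _); case: (_ == _);
    by rewrite ?(mul0r, mulr0, mul1r, mulr1, normr0) ?(ger0_norm r0)// sumr_ge0.
move=> w _; apply: cvgMr.
have [e e0 He] := near_at_rightP (Jr w (lexx 0)).
have Je n : mesh n < e -> forall u, 0 <= u -> u <= mesh n -> J u w = J 0 w.
  move=> ne u; rewrite le_eqVlt => /predU1P[<-//|u0] un.
  by apply: He => //; rewrite add0r (le_lt_trans un).
apply: (@cvg_trans _ ((1 - expR (- (mesh n * q (J 0 w)))) / mesh n *
    (J 0 w == j)%:R @[n --> \oo])).
  apply: near_eq_cvg; near=> n; have ne : mesh n < e.
    by near: n; exact: near_mesh_lt.
  rewrite (Je n ne (mesh n))// ?ltW//; congr ((1 - expR (- _)) / _ * _).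
  rewrite /slot_mean /mean_cars mul0r add0r.
  rewrite (@eq_Rintegral _ _ _ lebesgue_measure _ (fun=> q (J 0 w))); last first.
    by move=> u; rewrite inE /= in_itv /= => /andP[u0 un]; rewrite (Je n ne).
  rewrite Rintegral_cst//= lebesgue_measure_itv/= lte_fin mesh_gt0 -EFinB/=.
  by rewrite subr0 mulrC.
by apply: cvgMl; exact: one_sub_expRN_ratio_cvg.
Unshelve. all: by end_near. Qed.

Lemma normc_cexp_le1 (t : R) : 0 <= t -> normc (cexp (- s * t%:C)) <= 1.
Proof.
move=> t0; rewrite normc_cexp -expR0 ler_expR complex_ReM /= mulr0 subr0.
have -> : complex.Re (- s) = - complex.Re s by case: s.
by rewrite mulNr oppr_le0 mulr_ge0.
Qed.

Let discounted t i j : R[i] := cexp (- s * t%:C) * (phi t i j)%:C.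

Lemma discounted_ccvg t i j : 0 <= t ->
  ccvg t^'+ (fun u => discounted u i j) (discounted t i j).
Proof.
move=> t0; apply: ccvgM.
  apply: cexp_ccvg; apply: ccvgM; first exact: ccvg_cst.
  apply: ccvg_real; apply: cvg_within_filter; exact: cvg_id.
by apply: ccvg_real; exact: no_car_phase_right_cvg JQ AJ t i j t0.
Qed.

Lemma normc_discounted t i j : 0 <= t -> normc (discounted t i j) <= 1.
Proof.
move=> t0; rewrite ComplexField.Normc.normcM normc_real ?no_car_phase_ge0//.
apply: mulr_ile1.
- by rewrite normc_ge0.
- exact: no_car_phase_ge0.
- exact: normc_cexp_le1.
- exact: (no_car_phase_le1 JQ J0 AJ).
Qed.

Let B i k := cintegral lebesgue_measure `[0, T]
  (fun t : R => cexp (- s * t%:C) * (first_car_density P q J A t i k)%:C).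

Let z n := cexp (- s * (mesh n)%:C).

Let b n i k : R[i] := \sum_(p < n.+1) z n ^+ p.+1 *
  ((K (mesh n) false ^+ p * K (mesh n) true) i k)%:C.

Lemma coefficient_cvg i k : ccvg \oo (fun n => b n i k) (B i k).
Proof.
have mesh0 : mesh n @[n --> \oo] --> 0.
  apply/cvgrPdist_lt => e e0; near=> n; rewrite sub0r normrN ger0_norm ?ltW//.
  by near: n; exact: near_mesh_lt.
have z_cvg : ccvg \oo z 1.
  rewrite -(cexp0 R) -[X in cexp X](mulr0 (- s)); apply: cexp_ccvg.
  by apply: ccvgM; [exact: ccvg_cst|exact: ccvg_real].
have right_sum j : ccvg \oo (fun n => \sum_(p < n.+1)
    (mesh n)%:C * discounted (p.+1%:R * mesh n) i j)
    (cintegral lebesgue_measure `[0, T] (fun t => discounted t i j)).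
  apply: (@riemann_sum_ccvg R T (fun t => discounted t i j) 1) => //.
    by move=> t t0 _; exact: normc_discounted.
  by move=> t t0 _; exact: discounted_ccvg.
(* The discrete coefficients evaluate [phi] at left endpoints, while the Riemann sums above use
   right endpoints. The two sums differ by one boundary term of order [mesh n]. *)
have left_sum j : ccvg \oo (fun n => \sum_(p < n.+1)
    (mesh n)%:C * discounted (p%:R * mesh n) i j)
    (cintegral lebesgue_measure `[0, T] (fun t => discounted t i j)).
  rewrite -[X in ccvg _ _ X]addr0.
  rewrite -[X in _ + X](mul0r (discounted 0 i j - discounted T i j)).
  apply: (@ccvg_near _ _ \oo _ (fun n => \sum_(p < n.+1)
    (mesh n)%:C * discounted (p.+1%:R * mesh n) i j +
    (mesh n)%:C * (discounted 0 i j - discounted T i j))); last first.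
    apply: ccvgD => //; apply: ccvgM; last exact: ccvg_cst.
    exact: ccvg_real.
  apply: nearW => n; rewrite big_ord_recr /= [RHS]big_ord_recl /= mul0r.
  by rewrite (mesh_mul T n); under [in RHS]eq_bigr do rewrite /bump /= add1n; ring.
(* The constant rate is moved out of the complex integral by comparing the limits of the Riemann
   sums of both integrands. *)
have BE : B i k = cintegral lebesgue_measure `[0, T] (fun t => discounted t i k) * (q k)%:C.
  apply: (@ccvg_unique _ _ \oo _ (fun n => (\sum_(p < n.+1)
    (mesh n)%:C * discounted (p.+1%:R * mesh n) i k) * (q k)%:C)); last first.
    by apply: ccvgM; [exact: right_sum|exact: ccvg_cst].
  pose G t := cexp (- s * t%:C) * (first_car_density P q J A t i k)%:C.
  have GE t : G t = discounted t i k * (q k)%:C.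
    by rewrite /G /first_car_density mulrC rmorphM /discounted; ring.
  have -> : (fun n => (\sum_(p < n.+1)
      (mesh n)%:C * discounted (p.+1%:R * mesh n) i k) * (q k)%:C) =
      (fun n => \sum_(p < n.+1) (mesh n)%:C * G (p.+1%:R * mesh n)).
    by apply/funext => n; rewrite mulr_suml; apply: eq_bigr => p _; rewrite GE mulrA.
  apply: (@riemann_sum_ccvg R T G (q k)) => //.
    move=> t t0 _; rewrite GE ComplexField.Normc.normcM [normc (q k)%:C]normc_real//.
    by rewrite ler_piMl// normc_discounted.
  have -> : G = fun t => discounted t i k * (q k)%:C by exact/funext.
  by move=> t t0 _; apply: ccvgM; [exact: discounted_ccvg|exact: ccvg_cst].
(* The limit is rewritten as a product with the diagonal matrix of rates, to match the discrete
   coefficient term by term; the factor 1 is the limit of [z n]. *)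
have -> : B i k = \sum_j
    cintegral lebesgue_measure `[0, T] (fun t => discounted t i j) * (1 * ((j == k)%:R * q k)%:C).
  rewrite BE (bigD1 k)//= eqxx !mul1r big1 ?addr0// => j /negPf ->.
  by rewrite mul0r !mulr0.
(* One factor of [z n ^+ p.+1] is split off, leaving the discount at the left endpoint, and [mesh n]
   is inserted and divided out again. *)
have -> : (fun n => b n i k) = (fun n => \sum_j (\sum_(p < n.+1)
    (mesh n)%:C * discounted (p%:R * mesh n) i j) *
    (z n * (K (mesh n) true j k / mesh n)%:C)).
  apply/funext => n; rewrite /b.
  under [RHS]eq_bigr do rewrite mulr_suml.
  rewrite exchange_big /=; apply: eq_bigr => p _.
  rewrite mxE rmorph_sum mulr_sumr; apply: eq_bigr => j _.
  rewrite (pattern_kernel_expr q0 JQ J0 AJ)// /discounted -cexp_expr -/(z n) exprS.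
  have m0 : (mesh n)%:C != 0 by rewrite fmorph_eq0 gt_eqF.
  set a := phi (p%:R * mesh n) i j; set c := K (mesh n) true j k.
  move: a c (z n) (mesh n) m0.
  move=> a c y m m0.
  by rewrite !rmorphM fmorphV; field.
apply: ccvg_sum => j; apply: ccvgM; first exact: left_sum.
apply: ccvgM => //; apply: ccvg_real; exact: passage_rate_cvg.
Unshelve. all: by end_near. Qed.

(** The bound is proved for the discrete coefficients, where the powers of [z n] have modulus at
    most 1 and the row sums telescope. Its right-hand side is the same for every mesh, so it
    survives the limit. *)
Lemma coefficient_sum i : \sum_k normc (B i k) <= 1 - \sum_j phi T i j.
Proof.
have c : \sum_k normc (b n i k) @[n --> \oo] --> \sum_k normc (B i k).
  apply: cvg_big => [|k _]; first exact: add_continuous.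
  exact: ccvg_normc (coefficient_cvg i k).
rewrite -(cvg_lim _ c)//; apply: limr_le; first by apply/cvg_ex; eexists; exact: c.
apply: nearW => n.
have -> : \sum_j phi T i j = \sum_j (K (mesh n) false ^+ n.+1) i j.
  by apply: eq_bigr => j _; rewrite (pattern_kernel_expr q0 JQ J0 AJ)// (mesh_mul T n).
rewrite -first_car_sum// exchange_big /=; apply: ler_sum => k _.
rewrite (le_trans (normc_sum _ _))//; apply: ler_sum => p _.
have K0 : 0 <= (K (mesh n) false ^+ p * K (mesh n) true) i k.
  rewrite mxE; apply: sumr_ge0 => j _; rewrite mulr_ge0 ?pattern_kernel_ge0//.
  by rewrite (pattern_kernel_expr q0 JQ J0 AJ)// no_car_phase_ge0.
rewrite ComplexField.Normc.normcM normc_real// ler_piMl//.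
by rewrite cexp_expr normc_cexp_le1// mulr_ge0// ltW.
Qed.

Lemma service_lst_system : service_system P q J A T s (service_lst P J A T s).
Proof.
move=> i j.
pose W n k j := window_transform P J A (mesh n) n.+1 (z n) k j.
have z1 n : normc (z n) <= 1 by apply: normc_cexp_le1; exact: ltW.
have W_cvg k : ccvg \oo (fun n => W n k j) (service_lst P J A T s k j).
  apply: cond_expectation_cvg.
  - exact: Jm.
  - by move=> n; have [] := measurable_window_value JQ AJ (mesh_gt0 n) n.+1 (z n) j.
  - by move=> n; have [] := measurable_window_value JQ AJ (mesh_gt0 n) n.+1 (z n) j.
  - by move=> n w; exact: normc_window_value.
  - by move=> w; exact: (window_value_cvg (@Amono w) (Ar w) (Jr w) T0 s j).
apply: (ccvg_unique (W_cvg i)).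
(* The first term does not involve [n], because [n.+1] slots of length [mesh n] have total length
   exactly [T]. *)
apply: (@ccvg_near _ _ \oo _ (fun n => cexp (- s * T%:C) * (phi T i j)%:C +
    \sum_(k < N) W n k j * b n i k)); last first.
  apply: ccvgD; first exact: ccvg_cst.
  by apply: ccvg_sum => k; apply: ccvgM; [exact: W_cvg|exact: coefficient_cvg].
apply: nearW => n; rewrite /W (window_system q0 JQ J0 AJ (mesh_gt0 n) _ (z1 n)).
rewrite (pattern_kernel_expr q0 JQ J0 AJ)// (mesh_mul T n) /z cexp_expr (mesh_mul T n).
by congr (_ + _); apply: eq_bigr => k _; rewrite mulrC.
Qed.

(** A maximum principle: the equations do not mix different [j], and for fixed [j] the difference
    solves the homogeneous system. In a row where its modulus is largest, the coefficient bound
    below 1 forces it to vanish. *)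
Lemma service_system_unique X Y : service_system P q J A T s X ->
  service_system P q J A T s Y -> forall i j, X i j = Y i j.
Proof.
move=> sX sY i0 j; pose D k := X k j - Y k j.
have DE i : D i = \sum_k D k * B i k.
  rewrite /D sX sY opprD addrACA subrr add0r -sumrB.
  by apply: eq_bigr => k _; rewrite mulrBl.
have [i _ imax] := @arg_maxP _ _ _ i0 predT (fun k => normc (D k)) isT.
have Di0 : 0 <= normc (D i) by rewrite normc_ge0.
have : normc (D i) <= (1 - \sum_k phi T i k) * normc (D i).
  rewrite {1}DE (le_trans (normc_sum _ _))//.
  apply: (@le_trans _ _ (\sum_k normc (B i k) * normc (D i))).
    apply: ler_sum => k _; rewrite ComplexField.Normc.normcM mulrC ler_wpM2l//.
      by rewrite normc_ge0.
    exact: imax.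
  by rewrite -mulr_suml ler_wpM2r// coefficient_sum.
(* What remains is that the success probability of the first attempt times the maximal modulus is at
   most 0. *)
rewrite mulrBl mul1r lerBrDl gerDr => le0.
have Di : normc (D i) <= 0 by rewrite -(pmulr_rle0 _ (no_car_sum_gt0 i)).
have : normc (D i0) = 0.
  apply/eqP; rewrite eq_le (le_trans (imax i0 isT) Di)/=.
  by rewrite normc_ge0.
by move/ComplexField.Normc.eq0_normc/eqP; rewrite subr_eq0 => /eqP.
Qed.

End renewal_limit.

Theorem theorem1 (R : realType) (d : measure_display)
    (Omega : measurableType d) (P : probability Omega R)
    (N : nat) (hN : (1 <= N)%N) (Q : 'M[R]_N) (q : 'I_N -> R)
    (J : R -> Omega -> 'I_N) (A : R -> Omega -> nat)
    (hJA : mmpp P Q q J A)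
    (hJ0 : forall i : 'I_N, (0 < P (in_phase J 0 i))%E)
    (T : R) (hT : 0 < T) (s : R[i]) (hs : 0 <= complex.Re s) :
  service_system P q J A T s (service_lst P J A T s) /\
  (forall X : 'I_N -> 'I_N -> R[i],
     service_system P q J A T s X ->
     forall i j : 'I_N, X i j = service_lst P J A T s i j).
Proof.
have [_ q0 JQ AJ] := hJA.
have sys := service_lst_system q0 JQ hJ0 AJ hT hs.
split=> // X sX i j.
exact: (service_system_unique q0 JQ hJ0 AJ hT hs sX sys).
Qed.
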